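(* Let $F=f\circ\iota$ for some differentiable $G\times\widetilde G$-invariant map $\iota:M\times\mathfrak g\to\mathcal Q$ and some differentiable scalar function $f:\mathcal Q\to\mathbb R$, let $(m,\xi)\in M\times\mathfrak g$, and let $\mathcal V_{\rm int}\subseteq T_mM$ be a linear subspace satisfying $T_mM=\mathcal V_{\rm int}+\mathfrak g\cdot m$. Then $(m,\xi)$ is a relative critical point of $F$ if and only if $$df(\iota(m,\xi))\in\mathcal K_{\rm rig}(m,\xi;\iota)\cap\ker\left[\left(d\iota_\xi(m)|_{\mathcal V_{\rm int}}\right)^*\right],\qquad (1)$$ where $$\mathcal K_{\rm rig}(m,\xi;\iota):=\ker\left[\left(\frac{\partial\iota}{\partial\xi}(m,\xi)\circ\mathrm{ad}_\xi\right)^*\right].$$ If, in addition, $\mathcal Q=\mathcal Q_M\times\mathcal Q_\chi\times\mathcal Q_{\mathfrak g}$ and $\iota$ has the form $\iota(m,\xi)=(\phi(m),\chi(m,\xi),\alpha(\xi))$, then (1) is equivalent to the pair of conditions $$\frac{\partial f}{\partial\chi}(\iota(m,\xi))\in\mathcal K_{\rm rig}(m,\xi;\chi),\qquad \left(d_m\phi|_{\mathcal V_{\rm int}}\right)^*\left(\frac{\partial f}{\partial\phi}(\iota(m,\xi))\right)+\left(d_m\chi_\xi|_{\mathcal V_{\rm int}}\right)^*\left(\frac{\partial f}{\partial\chi}(\iota(m,\xi))\right)=0,\qquad(2)$$ where $\mathcal K_{\rm rig}(m,\xi;\chi):=\ker\left[\left(\frac{\partial\chi}{\partial\xi}(m,\xi)\circ\mathrm{ad}_\xi\right)^*\right]$.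 If moreover $\mathrm{range}\big[(d_m\phi|_{\mathcal V_{\rm int}})^*\big]$ and $\mathrm{range}\big[(d_m\chi_\xi|_{\mathcal V_{\rm int}})^*|_{\mathcal K_{\rm rig}(m,\xi;\chi)}\big]$ have trivial intersection, then (2) is satisfied if and only if $$\frac{\partial f}{\partial\phi}(\iota(m,\xi))\in\ker\left[(d_m\phi|_{\mathcal V_{\rm int}})^*\right]\quad\text{and}\quad\frac{\partial f}{\partial\chi}(\iota(m,\xi))\in\mathcal K_{\rm rig}(m,\xi;\chi)\cap\ker\left[(d_m\chi_\xi|_{\mathcal V_{\rm int}})^*\right].$$
   Context: $M$ is a manifold with a left action of a Lie group $G$ with Lie algebra $\mathfrak g$; another group $\widetilde G$ acts on $\mathfrak g$, and this action commutes with the adjoint action of $G$. The group $G\times\widetilde G$ acts on $M\times\mathfrak g$ by $(g,h)\cdot(m,\xi)=(g\cdot m,\,h\cdot\mathrm{Ad}_g\xi)$, and invariance of a map on $M\times\mathfrak g$ refers to this action. $\mathcal Q,\mathcal Q_M,\mathcal Q_\chi,\mathcal Q_{\mathfrak g}$ are manifolds, $\phi:M\to\mathcal Q_M$, $\chi:M\times\mathfrak g\to\mathcal Q_\chi$, $\alpha:\mathfrak g\to\mathcal Q_{\mathfrak g}$. A pair $(m,\xi)$ is a relative critical point of $F:M\times\mathfrak g\to\mathbb R$ if $m$ is a critical point of the function $F_\xi:M\to\mathbb R$, $F_\xi(m):=F(m,\xi)$. Notation: $\mathfrak g\cdot m=\{\eta_M(m):\eta\in\mathfrak g\}\subseteq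 T_mM$ is the tangent space to the $G$-orbit, where $\eta_M(m)=\frac{d}{dt}\exp(t\eta)\cdot m|_{t=0}$. $\iota_\xi(m):=\iota(m,\xi)$, $\chi_\xi(m):=\chi(m,\xi)$; $d\iota_\xi(m)=d_m\iota_\xi$ is the derivative at $m$. For a map $\Psi:M\times\mathfrak g\to N$, $\frac{\partial\Psi}{\partial\xi}(m,\xi):\mathfrak g\to T_{\Psi(m,\xi)}N$ is the linear map $\eta\mapsto d_{(m,\xi)}\Psi(0,\eta)$. $\mathrm{ad}_\xi\eta=[\xi,\eta]$. A superscript $*$ on a linear map denotes its dual (transpose) between dual spaces. For $f$ on $\mathcal Q_M\times\mathcal Q_\chi\times\mathcal Q_{\mathfrak g}$, the partial derivatives $\frac{\partial f}{\partial\phi}(p,x,a)\in T_p^*\mathcal Q_M$ and $\frac{\partial f}{\partial\chi}(p,x,a)\in T_x^*\mathcal Q_\chi$ are defined by $\frac{\partial f}{\partial\phi}(p,x,a)(\delta p)=df(p,x,a)(\delta p,0,0)$ and $\frac{\partial f}{\partial\chi}(p,x,a)(\delta x)=df(p,x,a)(0,\delta x,0)$. *)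

(* Defs.v *)
From HB Require Import structures.
From mathcomp Require Import all_boot all_order all_algebra.
From mathcomp Require Import all_classical all_reals topology normedtype landau derive.
Set Implicit Arguments.
Unset Strict Implicit.
Unset Printing Implicit Defensive.
Import Order.TTheory GRing.Theory Num.Theory.
Import numFieldNormedType.Exports.
Local Open Scope classical_set_scope.
Local Open Scope ring_scope.

(* Finite-dimensional normed real vector spaces: they serve both as model spaces
   of manifolds (through their norm) and as tangent spaces, whose subspaces and
   duals are handled by the vector library. *)
#[short(type="normedVectType")]
HB.structure Definition NormedVector (R : numFieldType) :=
  {V of NormedModule R V & Vector R V}.

HB.instance Definition _ (R : numFieldType) (V W : normedVectType R) :=
  Choice.on (V * W)%type.
HB.instance Definition _ (R : numFieldType) m n :=
  Choice.on 'M[R]_(m, n).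
HB.instance Definition _ (R : realType) := Choice.on (Real.sort R).

Section SmoothOn.
Variable R : realType.
Implicit Types E F H : normedModType R.

(* f is C^(k+1) on the open set U when it is differentiable on U and
   (x, v) |-> Df(x) v is C^k on U x E; in finite dimension this is the usual
   notion, since joint continuity of (x, v) |-> Df(x) v amounts to continuity
   of Df for the operator norm. *)
Fixpoint Ck_on (k : nat) : forall E F, set E -> (E -> F) -> Prop :=
  match k with
  | 0 => fun E F U f => forall x, U x -> {for x, continuous f}
  | k'.+1 => fun E F U f =>
      (forall x, U x -> differentiable f x) /\
      @Ck_on k' (E * E)%type F (U `*` setT) (fun p => 'd f (p.1) (p.2))
  end.

Definition smooth_on E F (U : set E) (f : E -> F) : Prop :=
  forall k, Ck_on k U f.

Lemma open_setX E F (U : set E) (V : set F) :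
  open U -> open V -> open (U `*` V).
Proof.
rewrite !openE => oU oV [x y] [/= Ux Vy].
by exists (U, V) => //=; split; [exact: oU|exact: oV].
Qed.

Lemma near_eq_diff E F (f g : E -> F) (x : E) :
  (\forall y \near x, f y = g y) -> differentiable f x ->
  differentiable g x /\ 'd g x = 'd f x :> (E -> F).
Proof.
move=> fg df; have [cf ef] := (diff_locallyP x f).1 df.
have eg : g \o shift x = cst (g x) + 'd f x +o_ (0 : E) id.
  rewrite -(nbhs_singleton fg); apply/eqaddoP => e e0.
  move: ef => /eqaddoP /(_ e e0) H1.
  have H2 : \forall h \near (0 : E), f (h + x) = g (h + x).
    by move: fg; rewrite (near_shift 0) /= subr0.
  by apply: filterS2 H1 H2 => h; rewrite /= !fctE /= => + <-.
have e := diff_unique cf eg.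
split; last exact: e.
apply/diff_locallyP; split; first exact: (eq_ind_r (fun h => continuous h) cf e).
exact: (eq_ind_r (fun h : E -> F => _ = cst (g x) + h +o_ (0 : E) id) eg e).
Qed.

Lemma eq_Ck_on k E F (U : set E) (f g : E -> F) :
  open U -> (forall x, U x -> f x = g x) -> Ck_on k U f -> Ck_on k U g.
Proof.
elim: k E F U f g => [|k IH] E F U f g oU fg /=.
  move=> cf x Ux; have fgx : \forall y \near x, f y = g y.
    by apply: filterS (open_nbhs_nbhs (conj oU Ux)) => y; exact: fg.
  have := cf x Ux; rewrite /prop_for /continuous_at (fg x Ux).
  by apply: cvg_trans; exact: near_eq_cvg.
case=> df Cf.
have fgd x : U x -> differentiable g x /\ 'd g x = 'd f x :> (E -> F).
  move=> Ux; apply: near_eq_diff (df x Ux).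
  by apply: filterS (open_nbhs_nbhs (conj oU Ux)) => y; exact: fg.
split=> [x /fgd[]//|].
apply: IH Cf; first by apply: open_setX => //; exact: openT.
by move=> [x v] [Ux _]; exact: (esym (congr1 (@^~ v) (fgd x Ux).2)).
Qed.

Lemma Ck_onW k E F (U : set E) (f : E -> F) : Ck_on k.+1 U f -> Ck_on k U f.
Proof.
elim: k E F U f => [|k IH] E F U f [df Cf].
  by move=> x Ux; apply: differentiable_continuous; exact: df.
by split=> //; apply: IH.
Qed.

Lemma Ck_on_subset k E F (U V : set E) (f : E -> F) :
  U `<=` V -> Ck_on k V f -> Ck_on k U f.
Proof.
elim: k E F U V f => [|k IH] E F U V f UV /=; first by move=> cf x /UV /cf.
case=> df Cf; split=> [x /UV /df //|].
by apply: IH Cf => -[x v] [/= /UV].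
Qed.

Lemma Ck_on_linear k E F (U : set E) (L : {linear E -> F}) :
  continuous L -> Ck_on k U L.
Proof.
elim: k E F U L => [|k IH] E F U L cL; first by move=> x _; exact: cL.
split=> [x _|]; first exact: linear_differentiable.
have linLs : linear (L \o snd : E * E -> F).
  by move=> a u v /=; rewrite linearP.
pose Ls := HB.pack_for {linear (E * E)%type -> F} (L \o snd : E * E -> F)
  (@GRing.isLinear.Build R (E * E)%type F _ _ linLs).
have -> : (fun p : E * E => 'd L (p.1) (p.2)) = Ls.
  by apply/funext => p; rewrite diff_lin.
by apply: IH => p; apply: continuous_comp; [exact: cvg_snd|exact: cL].
Qed.

Lemma Ck_on_fst k E F (U : set (E * F)) : Ck_on k U fst.
Proof.
have lin : linear (fst : E * F -> E) by [].
pose L := HB.pack_for {linear (E * F)%type -> E} (fst : E * F -> E)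
  (@GRing.isLinear.Build R (E * F)%type E _ _ lin).
by apply: (@Ck_on_linear _ _ _ _ L) => p; exact: cvg_fst.
Qed.

Lemma Ck_on_snd k E F (U : set (E * F)) : Ck_on k U snd.
Proof.
have lin : linear (snd : E * F -> F) by [].
pose L := HB.pack_for {linear (E * F)%type -> F} (snd : E * F -> F)
  (@GRing.isLinear.Build R (E * F)%type F _ _ lin).
by apply: (@Ck_on_linear _ _ _ _ L) => p; exact: cvg_snd.
Qed.

Lemma Ck_on_pair k E F H (U : set E) (f : E -> F) (g : E -> H) : open U ->
  Ck_on k U f -> Ck_on k U g -> Ck_on k U (fun x => (f x, g x)).
Proof.
elim: k E F H U f g => [|k IH] E F H U f g oU.
  by move=> cf cg x Ux; apply: cvg_pair; [exact: cf|exact: cg].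
move=> [df Cf] [dg Cg].
split=> [x Ux|]; first by apply: differentiable_pair; [exact: df|exact: dg].
have oUT : open (U `*` [set: E]) by apply: open_setX => //; exact: openT.
apply: eq_Ck_on (IH _ _ _ _ _ _ oUT Cf Cg) => // -[x v] [/= Ux _].
by rewrite diff_pair //=; [exact: df|exact: dg].
Qed.

Lemma Ck_on_comp k E F H (U : set E) (V : set F) (f : E -> F) (g : F -> H) :
  open U -> open V -> (forall x, U x -> V (f x)) ->
  Ck_on k U f -> Ck_on k V g -> Ck_on k U (g \o f).
Proof.
elim: k E F H U V f g => [|k IH] E F H U V f g oU oV UV Cf Cg.
  by move=> x Ux; apply: continuous_comp; [exact: Cf|apply: Cg; exact: UV].
have [df Df] := Cf; have [dg Dg] := Cg.
split=> [x Ux|].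
  by apply: differentiable_comp; [exact: df|apply: dg; exact: UV].
have oUT : open (U `*` [set: E]) by apply: open_setX => //; exact: openT.
have oVT : open (V `*` [set: F]) by apply: open_setX => //; exact: openT.
pose Tf := fun p : E * E => ((f \o fst) p, 'd f (p.1) (p.2)).
have CT : Ck_on k (U `*` [set: E]) Tf.
  apply: Ck_on_pair => //; apply: (IH _ _ _ _ U) => //.
  - by move=> x [].
  - exact: Ck_on_fst.
  - exact: Ck_onW.
have TU x : (U `*` [set: E]) x -> (V `*` [set: F]) (Tf x).
  by case=> /UV.
apply: eq_Ck_on (IH _ _ _ _ _ _ _ oUT oVT TU CT Dg) => // -[x v] [/= Ux _].
by rewrite (diff_comp (df x Ux) (dg _ (UV _ Ux))).
Qed.

Lemma smooth_on_prod E E' F F' (U : set E) (U' : set E')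
    (f : E -> F) (f' : E' -> F') : open U -> open U' ->
  smooth_on U f -> smooth_on U' f' ->
  smooth_on (U `*` U') (fun p => (f p.1, f' p.2)).
Proof.
move=> oU oU' Cf Cf' k.
have oUU := open_setX oU oU'.
apply: Ck_on_pair => //.
  by apply: (Ck_on_comp _ oU) (Cf k) => //; [move=> x []|exact: Ck_on_fst].
by apply: (Ck_on_comp _ oU') (Cf' k) => //; [move=> x []|exact: Ck_on_snd].
Qed.

End SmoothOn.

Section Manifolds.
Variable R : realType.

(* chart_map and chart_inv are total functions, meaningful only on the open sets
   chart_dom and chart_map @` chart_dom respectively. *)
Record chart (T : topologicalType) (E : normedModType R) := Chart {
  chart_dom : set T;
  chart_map :> T -> E;
  chart_inv : E -> T;
  chart_dom_open : open chart_dom;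
  chart_img_open : open (chart_map @` chart_dom);
  chart_mapK : forall x, chart_dom x -> chart_inv (chart_map x) = x;
  chart_map_cont : forall x, chart_dom x -> {for x, continuous chart_map};
  chart_inv_cont : forall y, (chart_map @` chart_dom) y ->
    {for y, continuous chart_inv}
}.

(* Finite-dimensional C^oo manifolds without boundary. The atlas is the family of
   the charts chart_at x; asking for a chosen chart around each point rather than
   for a set of charts loses no generality, and the choice serves below to
   realise tangent spaces. *)
Record manifold := Manifold {
  mfd_space :> topologicalType;
  model : normedVectType R;
  mfd_hausdorff : hausdorff_space mfd_space;
  mfd_second_countable : @second_countable mfd_space;
  chart_at : mfd_space -> chart mfd_space model;
  chart_at_dom : forall x, chart_dom (chart_at x) x;
  chart_compat : forall x y,
    smooth_on
      (chart_at x @` (chart_dom (chart_at x) `&` chart_dom (chart_at y)))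
      (chart_at y \o chart_inv (chart_at x))
}.

Lemma chart_open_image T E (c : chart T E) (A : set T) :
  open A -> A `<=` chart_dom c -> open (c @` A).
Proof.
move=> oA Ac; rewrite openE => _ [x Ax <-].
have xc := Ac _ Ax.
have cx : (c @` chart_dom c) (c x) by exists x.
have H1 : \forall y \near c x, (c @` chart_dom c) y.
  by apply: open_nbhs_nbhs; split=> //; exact: chart_img_open.
have H2 : \forall y \near c x, A (chart_inv c y).
  have := chart_inv_cont cx; rewrite /prop_for /continuous_at chart_mapK //.
  by apply; apply: open_nbhs_nbhs; split.
apply: filterS2 H1 H2 => _ [z zc <-]; rewrite (chart_mapK zc) => Az.
by exists z.
Qed.

Section VectManifold.
Variable V : normedVectType R.

Let vect_img_open : open ((id : V -> V) @` setT).
Proof. by rewrite image_id; exact: openT. Qed.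

Let vect_id_cont (P : set V) : forall x, P x -> {for x, continuous (id : V -> V)}.
Proof. by move=> x _; exact: cvg_id. Qed.

Definition vect_chart : chart V V :=
  @Chart V V setT id id openT vect_img_open (fun _ _ => erefl)
    (@vect_id_cont _) (@vect_id_cont _).

Lemma vect_second_countable : @second_countable V.
Proof.
pose d := \dim {: V}; pose b := vbasis {: V}.
pose c (q : {ffun 'I_d -> rat}) : V := \sum_i ratr (q i) *: b`_i.
pose B (p : {ffun 'I_d -> rat} * nat) : set V := ball (c p.1) p.2.+1%:R^-1.
exists (range B).
  exact: sub_countable (card_image_le _ _) (countableP _).
split; first by move=> _ [p _ <-]; apply: ball_open; rewrite invr_gt0.
move=> x A /nbhs_ballP[e /= e0 xA].
have [n ne] : exists n : nat, n.+1%:R^-1 < e / 2.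
  have [//|n] := @ltr_add_invr R 0 (e / 2); first by rewrite divr_gt0.
  by rewrite add0r => ne; exists n.
suff [q xq] : exists q, `|x - c q| < n.+1%:R^-1.
  exists (B (q, n)); first split.
  - by exists (q, n).
  - by rewrite /B /= -ball_normE /= distrC.
  move=> y; rewrite /B /= -ball_normE /= => cy; apply: xA.
  rewrite -ball_normE /= [e]splitr.
  rewrite -(subrKA (c q)) (le_lt_trans (ler_normD _ _)) // ltrD //.
    exact: lt_trans ne.
  exact: lt_trans ne.
pose M := 1 + \sum_(i < d) `|b`_i|.
have M0 : 0 < M by rewrite ltr_wpDr ?ltr01 // sumr_ge0.
pose r : R := n.+1%:R^-1 / M.
have r0 : 0 < r by rewrite divr_gt0 // invr_gt0.
have /fin_all_exists[q qP] (i : 'I_d) :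
    exists q : rat, `|coord b i x - ratr q| <= r.
  have /rat_in_itvoo[q] : coord b i x - r < coord b i x + r.
    by rewrite ltrD2l (lt_trans _ r0) // oppr_lt0.
  rewrite in_itv /= => /andP[q1 q2]; exists q.
  by rewrite distrC ler_distl (ltW q1) (ltW q2).
exists [ffun i => q i].
rewrite {1}(coord_vbasis (memvf x)) /c -sumrB.
apply: (@le_lt_trans _ _ (\sum_(i < d) r * `|b`_i|)).
  apply: le_trans (ler_norm_sum _ _ _) _; apply: ler_sum => i _.
  by rewrite ffunE -scalerBl normrZ ler_wpM2r.
rewrite -mulr_sumr /r -mulrA gtr_pMr ?invr_gt0 //.
by rewrite mulrC ltr_pdivrMr // mul1r /M ltrDr.
Qed.

Let vect_compat (x y : V) :
  smooth_on
    (vect_chart @` (chart_dom vect_chart `&` chart_dom vect_chart))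
    (vect_chart \o chart_inv vect_chart).
Proof. by move=> k; apply: (@Ck_on_linear _ _ _ _ _ idfun) => v; exact: cvg_id. Qed.

Definition vect_manifold : manifold :=
  @Manifold V V (@norm_hausdorff _ V) vect_second_countable
    (fun=> vect_chart) (fun=> I) vect_compat.

End VectManifold.

Section ProdManifold.
Variables M N : manifold.

Section ProdChart.
Variables (T U : topologicalType) (E F : normedModType R).
Variables (c : chart T E) (d : chart U F).

Lemma image_setX (A : set T) (B : set U) :
  (fun p => (c p.1, d p.2)) @` (A `*` B) = (c @` A) `*` (d @` B).
Proof.
apply/seteqP; split=> [_ [[x y] [/= Ax By] <-]|[_ _] [/= [x Ax <-] [y By <-]]].
  by split; [exists x|exists y].
by exists (x, y).
Qed.

Let prod_dom := chart_dom c `*` chart_dom d.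
Let prod_map (p : T * U) := (c p.1, d p.2).
Let prod_inv (p : E * F) := (chart_inv c p.1, chart_inv d p.2).

Let prod_dom_open : open prod_dom.
Proof.
rewrite openE => -[x y] [/= xc yd]; exists (chart_dom c, chart_dom d) => //=.
by split; apply: open_nbhs_nbhs; split=> //; exact: chart_dom_open.
Qed.

Let prod_img_open : open (prod_map @` prod_dom).
Proof. by rewrite image_setX; apply: open_setX; exact: chart_img_open. Qed.

Let prod_mapK x : prod_dom x -> prod_inv (prod_map x) = x.
Proof. by case: x => [x y] [/= xc yd]; rewrite /prod_inv /= !chart_mapK. Qed.

Let prod_map_cont x : prod_dom x -> {for x, continuous prod_map}.
Proof.
case: x => [x y] [/= xc yd]; apply: cvg_pair => /=.
  apply: (@cvg_comp _ _ _ fst c _ (nbhs x)); first exact: cvg_fst.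
  exact: chart_map_cont.
apply: (@cvg_comp _ _ _ snd d _ (nbhs y)); first exact: cvg_snd.
exact: chart_map_cont.
Qed.

Let prod_inv_cont y : (prod_map @` prod_dom) y -> {for y, continuous prod_inv}.
Proof.
rewrite image_setX; case: y => [x y] [/= xc yd]; apply: cvg_pair => /=.
  apply: (@cvg_comp _ _ _ fst (chart_inv c) _ (nbhs x)); first exact: cvg_fst.
  exact: chart_inv_cont.
apply: (@cvg_comp _ _ _ snd (chart_inv d) _ (nbhs y)); first exact: cvg_snd.
exact: chart_inv_cont.
Qed.

Definition prod_chart : chart (T * U)%type (E * F)%type :=
  @Chart _ (E * F)%type prod_dom prod_map prod_inv
    prod_dom_open prod_img_open prod_mapK prod_map_cont prod_inv_cont.

End ProdChart.

Lemma prod_hausdorff : hausdorff_space (M * N)%type.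
Proof.
move=> [x y] [x' y'] cl; congr pair; apply: mfd_hausdorff => A B xA xB.
  have [||[u v] [/= Au Bu]] := cl (fst @^-1` A) (fst @^-1` B).
  - exact: (@cvg_fst _ _ (nbhs x) (nbhs y)).
  - exact: (@cvg_fst _ _ (nbhs x') (nbhs y')).
  by exists u.
have [||[u v] [/= Au Bu]] := cl (snd @^-1` A) (snd @^-1` B).
- exact: (@cvg_snd _ _ (nbhs x) (nbhs y)).
- exact: (@cvg_snd _ _ (nbhs x') (nbhs y')).
by exists v.
Qed.

Lemma prod_second_countable : @second_countable (M * N)%type.
Proof.
have [A cA [oA bA]] := @mfd_second_countable M.
have [B cB [oB bB]] := @mfd_second_countable N.
exists [set S.1 `*` S.2 | S in A `*` B].
  exact: sub_countable (card_image_le _ _) (countableX cA cB).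
split.
  move=> _ [[S S'] [/= /oA oS /oB oS'] <-]; rewrite openE => -[x y] [/= Sx S'y].
  by exists (S, S') => //=; split; apply: open_nbhs_nbhs; split.
move=> [x y] W [[P Q] /= [/bA[S [AS Sx] SP] /bB[S' [BS' S'y] S'Q]] PQW].
exists (S `*` S'); first by split=> //; exists (S, S').
by move=> [u v] [/= /SP Pu /S'Q Qv]; apply: PQW.
Qed.

Let prod_chart_at (p : M * N) := prod_chart (chart_at p.1) (chart_at p.2).

Let prod_chart_at_dom p : chart_dom (prod_chart_at p) p.
Proof. by split; exact: chart_at_dom. Qed.

Let prod_compat p q :
  smooth_on
    (prod_chart_at p @`
      (chart_dom (prod_chart_at p) `&` chart_dom (prod_chart_at q)))
    (prod_chart_at q \o chart_inv (prod_chart_at p)).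
Proof.
case: p q => [x y] [x' y'] /=.
set U := _ @` _.
have -> : U =
    (chart_at x @` (chart_dom (chart_at x) `&` chart_dom (chart_at x'))) `*`
    (chart_at y @` (chart_dom (chart_at y) `&` chart_dom (chart_at y'))).
  by rewrite -image_setX setXI.
have oI (P : manifold) (u v : P) : open (chart_at u @`
    (chart_dom (chart_at u) `&` chart_dom (chart_at v))).
  apply: chart_open_image; last by move=> w [].
  by apply: openI; exact: chart_dom_open.
exact: (smooth_on_prod (oI M x x') (oI N y y')
  (chart_compat x x') (chart_compat y y')).
Qed.

Definition prod_manifold : manifold :=
  @Manifold (M * N)%type (model M * model N)%type prod_hausdorff
    prod_second_countable prod_chart_at prod_chart_at_dom prod_compat.

End ProdManifold.

End Manifolds.

Section LinearDuality.
Variable R : realType.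
Implicit Types V W : vectType R.

Definition dual V : vectType R := 'Hom(V, R).

Definition dual_map V W (L : 'Hom(V, W)) : 'Hom(dual W, dual V) :=
  linfun (fun l : dual W => (l \o L)%VF : dual V).

Definition lrestrict V W (U : {vspace V}) (L : 'Hom(V, W)) :
    'Hom(subvs_of U, W) :=
  (L \o linfun (@vsval _ _ U))%VF.

Lemma linear_linfunE V W (f : V -> W) (v : V) : linear f -> linfun f v = f v.
Proof.
move=> lf; pose L := HB.pack_for {linear V -> W} f
  (@GRing.isLinear.Build R V W _ f lf).
exact: (@lfunE _ _ _ L v).
Qed.

Lemma dual_mapE V W (L : 'Hom(V, W)) (l : dual W) (v : V) :
  (dual_map L l : 'Hom(V, R)) v = (l : 'Hom(W, R)) (L v).
Proof.
rewrite linear_linfunE ?comp_lfunE // => a u w.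
by rewrite comp_lfunDl comp_lfunZl.
Qed.

Lemma lrestrictE V W (U : {vspace V}) (L : 'Hom(V, W)) (u : subvs_of U) :
  lrestrict U L u = L (vsval u).
Proof. by rewrite comp_lfunE lfunE. Qed.

End LinearDuality.

Section Calculus.
Variable R : realType.
Implicit Types M N : manifold R.

Definition real_line : manifold R := vect_manifold R.

(* T_x M is realised as the model space, a tangent vector being represented by its
   coordinates in the chosen chart at x; accordingly mdiff f x is the derivative
   of f read in the chosen charts at x and at f x. *)
Definition tangent M (x : M) : normedVectType R := model M.

Definition cotangent M (x : M) : vectType R := dual (tangent x).

Definition local_rep M N (f : M -> N) (x : M) : model M -> model N :=
  chart_at (f x) \o f \o chart_inv (chart_at x).

(* Continuity ensures that f maps a neighbourhood of x into the domain of the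
   chart at f x, where local_rep is meaningful. *)
Definition mdifferentiable M N (f : M -> N) (x : M) : Prop :=
  {for x, continuous f} /\ differentiable (local_rep f x) (chart_at x x).

Definition mdiff M N (f : M -> N) (x : M) : 'Hom(tangent x, tangent (f x)) :=
  linfun ('d (local_rep f x) (chart_at x x)).

Definition smooth_map M N (f : M -> N) : Prop :=
  continuous f /\
  forall x y, smooth_on
    (chart_at x @` (chart_dom (chart_at x) `&` f @^-1` chart_dom (chart_at y)))
    (chart_at y \o f \o chart_inv (chart_at x)).

Definition velocity M (c : real_line -> M) (t : R) : tangent (c t) :=
  mdiff c t (1 : R).

Definition scalar_diff M (f : M -> R) (x : M) : cotangent x :=
  mdiff (f : M -> real_line) x.

Definition critical_point M (f : M -> R) (x : M) : Prop :=
  mdifferentiable (f : M -> real_line) x /\ scalar_diff f x = 0.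

(* Bracket of vector fields: DY X - DX Y in the chart at x. *)
Definition field_rep M (X : forall x : M, tangent x) (x : M)
    (y : model M) : model M :=
  mdiff (chart_at x : M -> vect_manifold (model M)) (chart_inv (chart_at x) y)
    (X (chart_inv (chart_at x) y)).

Definition field_bracket M (X Y : forall x : M, tangent x) (x : M) :
    tangent x :=
  'd (field_rep Y x) (chart_at x x) (X x) -
  'd (field_rep X x) (chart_at x x) (Y x).

End Calculus.

Definition is_action (T X : Type) (e : T) (op : T -> T -> T)
    (act : T -> X -> X) : Prop :=
  (forall x, act e x = x) /\ (forall g h x, act (op g h) x = act g (act h x)).

Record lie_group (R : realType) := LieGroup {
  lie_mfd :> manifold R;
  lie_one : lie_mfd;
  lie_mul : lie_mfd -> lie_mfd -> lie_mfd;
  lie_inv : lie_mfd -> lie_mfd;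
  lie_mulA : associative lie_mul;
  lie_mul1g : left_id lie_one lie_mul;
  lie_mulVg : left_inverse lie_one lie_inv lie_mul;
  lie_mul_smooth :
    smooth_map (fun p : prod_manifold lie_mfd lie_mfd => lie_mul p.1 p.2);
  lie_inv_smooth : smooth_map lie_inv
}.
Arguments lie_one {R} G : rename.

Section LieGroups.
Variables (R : realType) (G : lie_group R).

Definition lie_alg : normedVectType R := tangent (lie_one G).

Definition Ad (g : G) : 'Hom(lie_alg, lie_alg) :=
  mdiff (fun x : G => lie_mul (lie_mul g x) (lie_inv g)) (lie_one G).

(* The type tangent g is that of mdiff (lie_mul g) at 1, which takes values in
   the tangent space at lie_mul g 1 = g. *)
Definition left_field (xi : lie_alg) (g : G) : tangent g :=
  mdiff (lie_mul g) (lie_one G) xi.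

Definition lie_bracket (xi eta : lie_alg) : lie_alg :=
  field_bracket (left_field xi) (left_field eta) (lie_one G).

(* linfun f is the linear map equal to f when f is linear, as the bracket is. *)
Definition ad (xi : lie_alg) : 'Hom(lie_alg, lie_alg) :=
  linfun (lie_bracket xi).

Definition one_parameter_subgroup (eta : lie_alg) (c : real_line R -> G) :
    Prop :=
  [/\ smooth_map c, forall s t : R, c (s + t) = lie_mul (c s) (c t)
    & velocity c 0 = eta].

(* exp eta = c 1 for the one-parameter subgroup c with initial velocity eta, which
   exists and is unique; the default value of xget is never used. *)
Definition lie_exp (eta : lie_alg) : G :=
  xget (lie_one G) [set c (1 : R) | c in one_parameter_subgroup eta].

Variable M : manifold R.

Definition lie_action (act : G -> M -> M) : Prop :=
  is_action (lie_one G) (@lie_mul R G) act /\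
  smooth_map (fun p : prod_manifold G M => act p.1 p.2).

(* eta_M(m), the derivative at t = 0 of exp(t eta) . m *)
Definition inf_generator (act : G -> M -> M) (eta : lie_alg) (m : M) :
    tangent m :=
  velocity (fun t : real_line R => act (lie_exp ((t : R) *: eta)) m) 0.

Definition phase : manifold R := prod_manifold M (vect_manifold lie_alg).

Definition relative_critical_point (F : phase -> R) (p : phase) : Prop :=
  critical_point (fun m : M => F (m, p.2)) p.1.

Variable N : manifold R.

Definition diff_m (Psi : phase -> N) (m : M) (xi : lie_alg) :
    'Hom(tangent m, tangent (Psi (m, xi))) :=
  mdiff (fun m' : M => Psi (m', xi)) m.

Definition diff_xi (Psi : phase -> N) (m : M) (xi : lie_alg) :
    'Hom(lie_alg, tangent (Psi (m, xi))) :=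
  linfun (fun eta : lie_alg =>
    mdiff Psi (m, xi) ((0, eta) : model M * lie_alg)).

Lemma diff_xiE Psi m xi eta :
  diff_xi Psi m xi eta = mdiff Psi (m, xi) ((0, eta) : model M * lie_alg).
Proof.
rewrite linear_linfunE // => a u v; rewrite -linearP.
by congr (mdiff _ _ _); congr pair; rewrite /= scaler0 addr0.
Qed.

Definition K_rig (Psi : phase -> N) (m : M) (xi : lie_alg) :
    {vspace cotangent (Psi (m, xi))} :=
  lker (dual_map (diff_xi Psi m xi \o ad xi)%VF).

End LieGroups.

Section Partials.
Variables (R : realType) (QM Qchi Qg : manifold R).

Definition prod3 : manifold R := prod_manifold (prod_manifold QM Qchi) Qg.

Definition partial_phi (f : prod3 -> R) (q : prod3) : cotangent q.1.1 :=
  linfun (fun dp : model QM =>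
    scalar_diff f q ((dp, 0, 0) : model QM * model Qchi * model Qg)).

Definition partial_chi (f : prod3 -> R) (q : prod3) : cotangent q.1.2 :=
  linfun (fun dx : model Qchi =>
    scalar_diff f q ((0, dx, 0) : model QM * model Qchi * model Qg)).

Lemma partial_phiE f q dp :
  partial_phi f q dp =
  scalar_diff f q ((dp, 0, 0) : model QM * model Qchi * model Qg).
Proof.
rewrite linear_linfunE // => a u v; rewrite -linearP.
by congr (scalar_diff _ _ _); congr (_, _); rewrite /= ?scaler0 ?addr0 //;
  congr (_, _); rewrite /= ?scaler0 ?addr0.
Qed.

Lemma partial_chiE f q dx :
  partial_chi f q dx =
  scalar_diff f q ((0, dx, 0) : model QM * model Qchi * model Qg).
Proof.
rewrite linear_linfunE // => a u v; rewrite -linearP.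
by congr (scalar_diff _ _ _); congr (_, _); rewrite /= ?scaler0 ?addr0 //;
  congr (_, _); rewrite /= ?scaler0 ?addr0.
Qed.

End Partials.

(* Main.v *)
(* Differentiating iota(g.m, Ad_g xi) = iota(m, xi) in g at g = 1, in the
   direction eta, gives d iota_xi(m)(eta_M(m)) = d_xi iota(ad_xi eta), because the
   derivative of g |-> Ad_g xi at 1 is eta |-> -[xi, eta].  So df annihilates the
   image of g.m exactly when it annihilates that of ad_xi, and T_mM = V_int + g.m
   gives (1).  For a product, the same computation for alpha(Ad_g xi) = alpha(xi)
   shows that d alpha kills ad_xi, so alpha disappears from (1).

   In a chart at 1 with product mu, the derivative of Ad comes from differentiating
   (g x g^-1) g = g x in x and then in g, and comparing with the bracket of
   left-invariant fields requires the symmetry of the second derivative of mu.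
   The existence of the exponential map is never needed, only the uniqueness of
   one-parameter subgroups: if c and d have the same velocity at 0 then
   t |-> c(t) d(t)^-1 has derivative zero everywhere. *)
From HB Require Import structures.
Require Import Defs.
From mathcomp Require Import all_boot all_order all_algebra.
From mathcomp Require Import all_classical all_reals topology normedtype landau derive.
From mathcomp Require Import lra.
Import Order.TTheory GRing.Theory Num.Theory.
Import numFieldNormedType.Exports.
Local Open Scope classical_set_scope.
Local Open Scope ring_scope.
Set Implicit Arguments.
Unset Strict Implicit.
Unset Printing Implicit Defensive.

(** Two first-order expansions at the same base point are subtracted: the base value [c] and the
    shared linear term [d] drop out. Used in [second_difference]. *)
Lemma subrB_cancel (W : zmodType) (a b c d e : W) :
  a - c - (e + d) - (b - c - d) = a - b - e.
Proof.
rewrite [a - c - _]addrAC opprD addrA -[a - e - d - c]addrA -opprD.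
by rewrite -[b - c - d]addrA -opprD [c + d]addrC opprB addrA subrK addrAC.
Qed.

(** * Mean value inequality and symmetry of second derivatives *)

Section MeanValue.
Variable R : realType.
Implicit Types V W : normedModType R.

Lemma is_diff_near V W (f : V -> W) (x : V) (df : V -> W) : is_diff x f df ->
  forall e, 0 < e ->
  \forall y \near x, `|f y - f x - df (y - x)| <= e * `|y - x|.
Proof.
move=> [dfx <-] e e0; have [_ E] := (diff_locallyP x f).1 dfx.
move: E => /eqaddoP /(_ e e0) H.
rewrite (near_shift 0 x) /=; apply: filterS H => h.
by rewrite !fctE /= opprD addrA subr0 addrK.
Qed.

(** Values lie in a normed space, so a supremum argument is used: allow slack [e] in the slope and
    let [c] be the supremum of the points where the bound holds. Differentiability at [c] puts [c]
    in that set and, if [c < b], also a point beyond [c]. *)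
Lemma mean_value_ineq W (f f' : R -> W) (a b K : R) : a <= b ->
  (forall t, a <= t <= b -> is_diff t f (fun h => h *: f' t)) ->
  (forall t, a <= t <= b -> `|f' t| <= K) ->
  `|f b - f a| <= K * (b - a).
Proof.
move=> ab df f'K; apply/ler_addgt0Pr => e' e'0.
(* The accumulated excess [e * (b - a)] is then at most [e']; the 1 keeps the divisor positive when
   [a = b]. *)
pose e := e' / (b - a + 1).
have ba1 : 0 < b - a + 1 by rewrite ltr_wpDl // subr_ge0.
have e0 : 0 < e by rewrite divr_gt0.
suff : `|f b - f a| <= (K + e) * (b - a).
  move=> /le_trans; apply; rewrite mulrDl lerD2l /e -mulrA ger_pMr //.
  by rewrite ler_pdivrMl // mulr1 lerDl.
pose S := [set t | a <= t <= b /\ `|f t - f a| <= (K + e) * (t - a)].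
have Sa : S a by split; rewrite ?lexx ?ab // !subrr normr0 mulr0.
have supS : has_sup S by split; [exists a|exists b => t [/andP[]]].
pose c := sup S.
have ac : a <= c by exact: sup_upper_bound.
have cb : c <= b by apply: ge_sup; [exists a|move=> t [/andP[]]].
have cab : a <= c <= b by rewrite ac.
have cK := f'K c cab.
have dfc := is_diff_near (df c cab) e0.
have {dfc} [d /= d0 dfc] : exists2 d : R, 0 < d & forall y, `|y - c| < d ->
    `|f y - f c| <= (K + e) * `|y - c|.
  have /nbhs_ballP[d /= d0 H] := dfc.
  exists d => // y yc; have := H y; rewrite /ball /= distrC => /(_ yc) Hy.
  rewrite -(subrK ((y - c) *: f' c) (f y - f c)).
  rewrite (le_trans (ler_normD _ _)) // mulrDl addrC lerD // normrZ mulrC.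
  by rewrite ler_wpM2r.
have Sc : S c.
  split=> //.
  have [t St ct] := sup_adherent d0 supS.
  have tc : t <= c by exact: sup_upper_bound.
  have [_ Kt] := St.
  have tcd : `|t - c| < d.
    by rewrite distrC ger0_norm ?subr_ge0 // ltrBlDl -ltrBlDr.
  have := dfc t tcd; rewrite distrC [`|t - c|]distrC ger0_norm ?subr_ge0 // => H.
  rewrite -(subrKA (f t)) (le_trans (ler_normD _ _)) //.
  by rewrite (le_trans (lerD H Kt)) // -mulrDr subrKA.
have [cb'|bc] := ltP c b; last first.
  have -> : b = c by apply/eqP; rewrite eq_le bc.
  by have [_] := Sc.
(* A point beyond [c], still at most [b] and within [d] of [c]; its membership in [S] contradicts
   the choice of [c]. *)
pose t := Num.min b (c + d / 2).
have ct : c < t by rewrite /t lt_min cb' ltrDl divr_gt0.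
have tb : t <= b by rewrite /t ge_min lexx.
have tc0 : 0 <= t - c by rewrite subr_ge0 ltW.
have tcd : `|t - c| < d.
  rewrite (ger0_norm tc0) ltrBlDl (@le_lt_trans _ _ (c + d / 2)) //.
    by rewrite /t ge_min lexx orbT.
  by rewrite ltrD2l gtr_pMr // invf_lt1 // ltr1n.
suff St : S t.
  by have := sup_upper_bound supS St; rewrite leNgt ct.
split; first by rewrite tb (le_trans ac (ltW ct)).
have := dfc t tcd; rewrite (ger0_norm tc0) => H.
rewrite -(subrKA (f c)) (le_trans (ler_normD _ _)) //.
by rewrite (le_trans (lerD H Sc.2)) // -mulrDr subrKA.
Qed.

Lemma is_diff_line V W (f : V -> W) (x u : V) (t : R) (df : V -> W) :
  is_diff (x + t *: u) f df ->
  is_diff t (fun s : R => f (x + s *: u)) (fun h => h *: df u).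
Proof.
move=> dfx.
have dl : is_diff t (fun s : R => x + s *: u) (fun h : R => h *: u).
  have H := is_diffD (is_diff_cst x t) (is_diff_scalel t u).
  by apply: is_diff_eq H _; apply/funext => h; rewrite !fctE add0r.
apply: is_diff_eq (is_diff_comp dl dfx) _; apply/funext => h /=.
by rewrite -(diff_val (is_diff_def := dfx)) linearZ.
Qed.

(** The second difference is the increment over [0, s] of t |-> f (x + s v + t u) - f (x + t u).
    Once the expected linear term is subtracted, the derivative is a difference of two first-order
    remainders of the directional derivative [h] at [x], and [mean_value_ineq] applies. *)
Lemma second_difference V W (f : V -> W) (x u v : V) :
  (\forall y \near x, differentiable f y) ->
  differentiable (fun y => 'd f y u) x ->
  forall e : R, 0 < e -> \forall s \near 0^'+,
   `|f (x + s *: u + s *: v) - f (x + s *: u) - f (x + s *: v) + f x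
     - (s * s) *: 'd (fun y => 'd f y u) x v| <= e * (s * s).
Proof.
move=> df dfu e e0; set h := fun y => 'd f y u.
(* Two remainders occur, each at distance at most s(|u| + |v|) from [x], whence the factor 2; the 1
   keeps [L] positive even if [u] and [v] vanish. *)
pose L := 2 * (`|u| + `|v|) + 1.
have L0 : 0 < L by rewrite ltr_wpDl // mulr_ge0 // addr_ge0.
pose e' := e / L; have e'0 : 0 < e' by rewrite divr_gt0.
have dh := is_diff_near (differentiableP dfu) e'0.
have [r /= r0 Hr] : exists2 r : R, 0 < r & forall y, `|y| < r ->
    differentiable f (x + y) /\ `|h (x + y) - h x - 'd h x y| <= e' * `|y|.
  have [r /= r0 H] := (nbhs_ballP _ _).1 (filterI df dh).
  exists r => // y yr; have := H (x + y).
  rewrite -ball_normE /= opprD addrA subrr sub0r normrN => /(_ yr) [? ].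
  by rewrite [x + y - x]addrAC subrr add0r.
near=> s.
have s0 : 0 < s by near: s; exact: nbhs_right_gt.
have sL : s * L < r.
  rewrite -ltr_pdivlMr //; near: s; apply: nbhs_right_lt; exact: divr_gt0.
pose g t := f (x + s *: v + t *: u) - f (x + t *: u) - t *: (s *: 'd h x v).
pose g' t := h (x + s *: v + t *: u) - h (x + t *: u) - s *: 'd h x v.
have in_ball t k : 0 <= t <= s -> 0 <= k <= s -> `|k *: v + t *: u| < r /\
    `|k *: v + t *: u| <= s * (`|u| + `|v|).
  move=> /andP[t0 ts] /andP[k0 ks].
  have H : `|k *: v + t *: u| <= s * (`|u| + `|v|).
    rewrite (le_trans (ler_normD _ _)) // !normrZ !ger0_norm // addrC mulrDr.
    by rewrite lerD // ler_wpM2r.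
  split=> //; rewrite (le_lt_trans H) // (le_lt_trans _ sL) // ler_pM2l //.
  by have := normr_ge0 u; have := normr_ge0 v; rewrite /L; lra.
have ss : 0 <= s <= s by rewrite (ltW s0) lexx.
have s00 : (0 : R) <= 0 <= s by apply/andP; split; [exact: lexx|exact: ltW].
have dg t : 0 <= t <= s -> is_diff t g (fun k => k *: g' t).
  move=> ts.
  have [b1 _] := in_ball _ _ ts ss; have [b2 _] := in_ball _ _ ts s00.
  have [d1 _] := Hr _ b1; have [d2 _] := Hr _ b2.
  rewrite addrA in d1; rewrite scale0r add0r in d2.
  have D1 := is_diff_line (differentiableP d1).
  have D2 := is_diff_line (differentiableP d2).
  have D3 := is_diff_scalel t (s *: 'd h x v).
  apply: is_diff_eq (is_diffB (is_diffB D1 D2) D3) _.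
  by apply/funext => k; rewrite !fctE /g' !scalerBr.
have g'K t : 0 <= t <= s -> `|g' t| <= e * s.
  move=> ts.
  have [b1 l1] := in_ball _ _ ts ss; have [b2 l2] := in_ball _ _ ts s00.
  have [_ H1] := Hr _ b1; have [_ H2] := Hr _ b2.
  (* The term [0 *: v] gives both remainders the shape of [H1] and [H2]. *)
  have -> : g' t = (h (x + (s *: v + t *: u)) - h x - 'd h x (s *: v + t *: u))
     - (h (x + (0 *: v + t *: u)) - h x - 'd h x (0 *: v + t *: u)).
    by rewrite scale0r add0r linearD linearZ /= subrB_cancel /g' addrA.
  rewrite (le_trans (ler_normB _ _)) // (le_trans (lerD H1 H2)) // -mulrDr.
  rewrite (le_trans (ler_wpM2l (ltW e'0) (lerD l1 l2))) //.
  have -> : e * s = e' * (s * L) by rewrite /e' mulrCA mulfVK ?gt_eqF // mulrC.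
  by rewrite ler_pM2l // -mulrDr ler_pM2l // /L; lra.
have := mean_value_ineq (ltW s0) dg g'K.
rewrite subr0 -mulrA; congr (_ <= _); congr (`|_|).
rewrite /g !scale0r !addr0 subr0 scalerA opprB.
rewrite [_ - _ - _ + _]addrAC [x + s *: v + _]addrAC; congr (_ - _).
by rewrite addrA [in RHS]addrAC.
Unshelve. all: by end_near. Qed.

(** The second difference is symmetric in [u] and [v], and by [second_difference] each mixed
    derivative, multiplied by [s * s], approximates it up to o(s^2). *)
Lemma diff_sym V W (f : V -> W) (x u v : V) :
  (\forall y \near x, differentiable f y) ->
  differentiable (fun y => 'd f y u) x ->
  differentiable (fun y => 'd f y v) x ->
  'd (fun y => 'd f y u) x v = 'd (fun y => 'd f y v) x u.
Proof.
move=> df du dv; apply/eqP; rewrite -subr_eq0 -normr_le0.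
apply/ler_addgt0Pr => e e0; rewrite add0r.
have e20 : 0 < e / 2 by exact: divr_gt0.
near (0 : R)^'+ => s.
have s0 : 0 < s by near: s; exact: nbhs_right_gt.
have Hu : `|f (x + s *: u + s *: v) - f (x + s *: u) - f (x + s *: v) + f x
     - (s * s) *: 'd (fun y => 'd f y u) x v| <= (e / 2) * (s * s).
  by near: s; exact: second_difference.
have Hv : `|f (x + s *: v + s *: u) - f (x + s *: v) - f (x + s *: u) + f x
     - (s * s) *: 'd (fun y => 'd f y v) x u| <= (e / 2) * (s * s).
  by near: s; exact: second_difference.
have ss0 : 0 < s * s by exact: mulr_gt0.
rewrite -(ler_pM2r ss0) -[s * s in leLHS](ger0_norm (ltW ss0)) mulrC -normrZ.
move: Hu Hv; rewrite scalerBr [x + s *: v + _]addrAC [_ - f (x + s *: v) - _]addrAC.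
set D := _ + f x; rewrite distrC => Hu Hv.
rewrite -(subrKA D) (le_trans (ler_normD _ _)) // (le_trans (lerD Hu Hv)) //.
by rewrite -mulrDl -splitr.
Unshelve. all: by end_near. Qed.

End MeanValue.

(** * Germs of [C^k] maps, and the derivative of conjugation in a chart *)

Section NearSmoothness.
Variable R : realType.
Implicit Types E F H : normedModType R.

Lemma is_diff_eq_near E F (f g df : E -> F) (x : E) : is_diff x f df ->
  (\forall y \near x, f y = g y) -> is_diff x g df.
Proof.
by move=> [dfx <-] fg; have [dg e] := near_eq_diff fg dfx; exact: DiffDef.
Qed.

Lemma is_diff_uniq E F (f df dg : E -> F) (x : E) :
  is_diff x f df -> is_diff x f dg -> df = dg.
Proof. by move=> [_ <-] [_ <-]. Qed.

Lemma is_diff_insl E F (x : E) (c : F) :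
  is_diff x (fun y => (y, c)) (fun h => (h, 0)).
Proof. exact: is_diff_pair (is_diff_id x) (is_diff_cst c x). Qed.

Lemma is_diff_insr E F (x : F) (c : E) :
  is_diff x (fun y => (c, y)) (fun h => (0, h)).
Proof. exact: is_diff_pair (is_diff_cst c x) (is_diff_id x). Qed.

Lemma is_diff_fst E F (p : E * F) : is_diff p fst fst.
Proof.
have lin : linear (fst : E * F -> E) by [].
pose L := HB.pack_for {linear (E * F)%type -> E} (fst : E * F -> E)
  (@GRing.isLinear.Build R (E * F)%type E _ _ lin).
have cL : continuous L by move=> q; exact: cvg_fst.
split; [exact: (@linear_differentiable _ _ _ L)|exact: (@diff_lin _ _ _ L)].
Qed.

Lemma is_diff_snd E F (p : E * F) : is_diff p snd snd.
Proof.
have lin : linear (snd : E * F -> F) by [].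
pose L := HB.pack_for {linear (E * F)%type -> F} (snd : E * F -> F)
  (@GRing.isLinear.Build R (E * F)%type F _ _ lin).
have cL : continuous L by move=> q; exact: cvg_snd.
split; [exact: (@linear_differentiable _ _ _ L)|exact: (@diff_lin _ _ _ L)].
Qed.

Lemma linear_pair E F H (L : {linear (E * F)%type -> H}) a b :
  L (a, b) = L (a, 0) + L (0, b).
Proof.
rewrite -linearD; congr (L _).
have -> : (a, 0) + (0, b) = (a + 0, 0 + b) by [].
by rewrite addr0 add0r.
Qed.

(** A property of the germ at [x], since chart representations are meaningful only near the base
    point. *)
Definition Ck_near k E F (f : E -> F) (x : E) :=
  exists2 U, open_nbhs x U & Ck_on k U f.

Lemma Ck_near_diff k E F (f : E -> F) (x : E) : Ck_near k.+1 f x ->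
  \forall y \near x, differentiable f y.
Proof.
by case=> U oU [df _]; apply: filterS (open_nbhs_nbhs oU) => y /df.
Qed.

Lemma Ck_near_tangent k E F (f : E -> F) (x v : E) : Ck_near k.+1 f x ->
  Ck_near k (fun p : E * E => 'd f (p.1) (p.2)) (x, v).
Proof.
case=> U [oU Ux] [_ Cf]; exists (U `*` setT) => //.
by split=> //; apply: open_setX => //; exact: openT.
Qed.

(* mu and kap are the chart representations at (1, 1) of (y, x) |-> y x and of
   (y, x) |-> y x y^-1, and o is the coordinate of 1: then X xi is the left-invariant
   field xi and A xi y is Ad_y xi. *)
Section Conjugation.
Variables (E : normedModType R) (mu kap : E * E -> E) (o : E).
Hypothesis mu_C2 : Ck_near 2 mu (o, o).
Hypothesis kap_C2 : Ck_near 2 kap (o, o).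
Hypothesis muo : \forall y \near o, mu (y, o) = y.
Hypothesis kapo : \forall y \near o, kap (o, y) = y.
Hypothesis kap_o : \forall y \near o, kap (y, o) = o.
Hypothesis mu_kap : \forall p \near (o, o), mu (kap p, p.1) = mu p.

Let X xi y := 'd mu (y, o) (0, xi).
Let A xi y := 'd kap (y, o) (0, xi).

Lemma near_insl (P : set (E * E)) :
  (\forall p \near (o, o), P p) -> \forall y \near o, P (y, o).
Proof.
by have [d _] := is_diff_insl o o; have := differentiable_continuous d; apply.
Qed.

Lemma near_insr (y : E) (P : set (E * E)) :
  (\forall p \near (y, o), P p) -> \forall x \near o, P (y, x).
Proof.
by have [d _] := is_diff_insr o y; have := differentiable_continuous d; apply.
Qed.

(** Base point and vector form a single variable, so that the chain rule covers expressions in which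
    both move with [y], as in [intertwine]. *)
Let T (q : (E * E) * (E * E)) := 'd mu (q.1) (q.2).

Let diff_mu : \forall p \near (o, o), differentiable mu p.
Proof. exact: Ck_near_diff mu_C2. Qed.

Let diff_T w : differentiable T ((o, o), w).
Proof. exact: nbhs_singleton (Ck_near_diff (Ck_near_tangent w mu_C2)). Qed.

Let diff_T_fst w :
  is_diff (o, o) (fun p => 'd mu p w) (fun h => 'd T ((o, o), w) (h, 0)).
Proof.
have d := is_diff_comp (is_diff_insl (o, o) w) (differentiableP (diff_T w)).
exact: d.
Qed.

Let diff_X xi : is_diff o (X xi) (fun h => 'd (fun p => 'd mu p (0, xi)) (o, o) (h, 0)).
Proof.
have d := is_diff_comp (is_diff_insl o o)
  (differentiableP (ex_diff (is_diff_def := diff_T_fst (0, xi)))).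
exact: d.
Qed.

Lemma differentiable_left_field_rep xi : differentiable (X xi) o.
Proof. exact: (ex_diff (is_diff_def := diff_X xi)). Qed.

Lemma differentiable_conj_rep xi : differentiable (A xi) o.
Proof.
have dT := nbhs_singleton (Ck_near_diff (Ck_near_tangent (0, xi) kap_C2)).
have d := is_diff_comp (is_diff_insl o o)
  (is_diff_comp (is_diff_insl (o, o) (0, xi)) (differentiableP dT)).
exact: (ex_diff (is_diff_def := d)).
Qed.

(** Both sides are mixed second derivatives of [mu] at [(o, o)]; [diff_sym] exchanges the directions
    [(xi, 0)] and [(0, eta)]. *)
Let mixed xi eta : 'd (fun p => 'd mu p (xi, 0)) (o, o) (0, eta) = 'd (X eta) o xi.
Proof.
rewrite (diff_val (is_diff_def := diff_X eta)); apply: diff_sym => //.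
- exact: (ex_diff (is_diff_def := diff_T_fst _)).
- exact: (ex_diff (is_diff_def := diff_T_fst _)).
Qed.

Let A_o xi : A xi o = xi.
Proof.
have dk := nbhs_singleton (Ck_near_diff kap_C2).
have d := is_diff_comp (is_diff_insr o o) (differentiableP dk).
have := is_diff_uniq (is_diff_eq_near d kapo) (is_diff_id o).
by move=> /(congr1 (@^~ xi)).
Qed.

Let d1mu w : 'd mu (o, o) (w, 0) = w.
Proof.
have dm := nbhs_singleton diff_mu.
have d := is_diff_comp (is_diff_insl o o) (differentiableP dm).
have := is_diff_uniq (is_diff_eq_near d muo) (is_diff_id o).
by move=> /(congr1 (@^~ w)).
Qed.

(** Obtained by differentiating (y x y^-1) y = y x in x at the identity, with y fixed. *)
Let intertwine xi : \forall y \near o, T ((o, y), (A xi y, 0)) = X xi y.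
Proof.
near=> y.
have ky : kap (y, o) = o by near: y.
have dmu : differentiable mu (o, y) by near: y; exact: near_insr diff_mu.
have dmu' : differentiable mu (y, o) by near: y; exact: near_insl diff_mu.
have dkap : differentiable kap (y, o).
  by near: y; exact: near_insl (Ck_near_diff kap_C2).
have L1 := is_diff_comp (is_diff_insr o y) (differentiableP dkap).
pose f x := (kap (y, x), y).
have L2 : is_diff o f (fun h => ('d kap (y, o) (0, h), 0)).
  exact: is_diff_pair L1 (is_diff_cst y o).
have fo : f o = (o, y) by rewrite /f ky.
have dmuf : differentiable mu (f o) by rewrite fo.
have L3 := is_diff_comp L2 (differentiableP dmuf).
have R1 := is_diff_comp (is_diff_insr o y) (differentiableP dmu').
have e : \forall x \near o, mu (kap (y, x), y) = mu (y, x).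
  (* Differentiating at [(y, o)] requires the identity on a neighbourhood of that point;
     [nbhs_interior] supplies one for every [y] near [o]. *)
  have mk : \forall p \near (y, o), mu (kap p, p.1) = mu p.
    by near: y; exact: near_insl (nbhs_interior mu_kap).
  exact: near_insr mk.
have L4 := is_diff_eq_near L3 e.
have := is_diff_uniq L4 R1.
by move=> /(congr1 (@^~ xi)) /=; rewrite fo.
Unshelve. all: by end_near. Qed.

Let T_fst w h : 'd T ((o, o), w) (h, 0) = 'd (fun p => 'd mu p w) (o, o) h.
Proof.
exact: esym (congr1 (@^~ h) (diff_val (is_diff_def := diff_T_fst w))).
Qed.

Let T_snd w k : 'd T ((o, o), w) (0, k) = 'd mu (o, o) k.
Proof.
have d := is_diff_comp (is_diff_insr w (o, o)) (differentiableP (diff_T w)).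
have cmu := diff_continuous (nbhs_singleton diff_mu).
exact: esym (congr1 (@^~ k) (etrans (esym (diff_lin w cmu))
  (diff_val (is_diff_def := d)))).
Qed.

(** Differentiate [intertwine] in [y] at [o] along [eta]. The motion of the base point contributes
    ['d (X eta) o xi] by [mixed]; the motion of the vector contributes ['d (A xi) o eta] by
    [d1mu]. *)
Lemma diff_conj_rep xi eta : 'd (A xi) o eta = 'd (X xi) o eta - 'd (X eta) o xi.
Proof.
have dA := differentiableP (differentiable_conj_rep xi).
pose g y : (E * E) * (E * E) := ((o, y), (A xi y, 0)).
have dl : is_diff o g (fun h => ((0, h), ('d (A xi) o h, 0))).
  exact: is_diff_pair (is_diff_insr _ _) (is_diff_pair dA (is_diff_cst 0 o)).
have dT : differentiable T (g o) by exact: diff_T.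
have d1 := is_diff_eq_near (is_diff_comp dl (differentiableP dT)) (intertwine xi).
have H := congr1 (@^~ eta) (is_diff_uniq d1
  (differentiableP (differentiable_left_field_rep xi))).
have go : g o = ((o, o), (xi, 0)) by rewrite /g A_o.
rewrite go in H.
have {}H : 'd T ((o, o), (xi, 0)) ((0, eta), ('d (A xi) o eta, 0)) =
  'd (X xi) o eta by exact: H.
have Hpair := linear_pair ('d T ((o, o), (xi, 0))) (0, eta) ('d (A xi) o eta, 0).
have Hfst := etrans (T_fst (xi, 0) (0, eta)) (mixed xi eta).
have Hsnd := etrans (T_snd (xi, 0) ('d (A xi) o eta, 0)) (d1mu _).
have aux (a b c : E) : b + a = c -> a = c - b.
  by move=> <-; rewrite addrAC subrr add0r.
exact: aux (etrans (esym (congr2 +%R Hfst Hsnd)) (etrans (esym Hpair) H)).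
Qed.

End Conjugation.
End NearSmoothness.

(** * Derivatives of maps between manifolds *)

Section ManifoldCalculus.
Variable R : realType.
Implicit Types M N P : manifold R.

Lemma near_chart_inv M (x : M) (Q : set M) : (\forall z \near x, Q z) ->
  \forall y \near chart_at x x, Q (chart_inv (chart_at x) y).
Proof.
move=> Qx; have dx := chart_at_dom x.
have cx : (chart_at x @` chart_dom (chart_at x)) (chart_at x x) by exists x.
have := chart_inv_cont cx.
by rewrite /prop_for /continuous_at chart_mapK //; apply.
Qed.

Lemma near_chart_img M (x : M) : \forall y \near chart_at x x,
  (chart_at x @` chart_dom (chart_at x)) y.
Proof.
apply: open_nbhs_nbhs; split; first exact: chart_img_open.
by exists x => //; exact: chart_at_dom.
Qed.

Lemma near_chart_invK M (x : M) : \forall y \near chart_at x x,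
  chart_at x (chart_inv (chart_at x) y) = y.
Proof.
by apply: filterS (near_chart_img x) => _ [z zx <-]; rewrite chart_mapK.
Qed.

Lemma near_chart_dom M (x : M) : \forall z \near x, chart_dom (chart_at x) z.
Proof.
apply: open_nbhs_nbhs; split; first exact: chart_dom_open.
exact: chart_at_dom.
Qed.

(** By continuity, points near [x] are sent into the chart domain at [f x], where [chart_inv] undoes
    the chart. *)
Lemma near_local_rep_comp M N P (f : M -> N) (g : N -> P) (x : M) :
  {for x, continuous f} -> \forall y \near chart_at x x,
  (local_rep g (f x) \o local_rep f x) y = local_rep (g \o f) x y.
Proof.
move=> cf; apply: filterS (near_chart_inv (cf _ (near_chart_dom (f x)))) => y yd.
by rewrite /local_rep /= chart_mapK.
Qed.

(** The derivative goes between model spaces, so it keeps its type when a base point is rewritten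
    along an equality such as [act e m = m]. *)
Definition is_mdiff M N (f : M -> N) (x : M) (df : model M -> model N) :=
  {for x, continuous f} /\ is_diff (chart_at x x) (local_rep f x) df.

Lemma is_mdiff_mdiff M N (f : M -> N) x df v :
  is_mdiff f x df -> mdiff f x v = df v.
Proof. by case=> _ [_ <-]; rewrite /mdiff lfunE. Qed.

Lemma is_mdiff_differentiable M N (f : M -> N) x df :
  is_mdiff f x df -> mdifferentiable f x.
Proof. by case=> cf [d _]. Qed.

Lemma mdifferentiableP M N (f : M -> N) x :
  mdifferentiable f x -> is_mdiff f x (mdiff f x).
Proof.
case=> cf d; split=> //; apply: DiffDef => //.
by apply/funext => v; rewrite /mdiff lfunE.
Qed.

Lemma is_mdiff_uniq M N (f : M -> N) x df dg :
  is_mdiff f x df -> is_mdiff f x dg -> df = dg.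
Proof. by case=> _ d1 [_ d2]; exact: is_diff_uniq d1 d2. Qed.

Lemma is_mdiff_comp M N P (f : M -> N) (g : N -> P) x df dg :
  is_mdiff f x df -> is_mdiff g (f x) dg -> is_mdiff (g \o f) x (dg \o df).
Proof.
move=> [cf df_] [cg dg_]; split; first exact: continuous_comp.
apply: is_diff_eq_near (near_local_rep_comp g cf).
have e : local_rep f x (chart_at x x) = chart_at (f x) (f x).
  by rewrite /local_rep /= chart_mapK //; exact: chart_at_dom.
apply: is_diff_comp => //; rewrite e; exact: dg_.
Qed.

Lemma is_mdiff_eq_near M N (f g : M -> N) x df :
  is_mdiff f x df -> (\forall y \near x, f y = g y) -> is_mdiff g x df.
Proof.
move=> [cf df_] fg; have fgx := nbhs_singleton fg; split.
  rewrite /prop_for /continuous_at -fgx.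
  apply: cvg_trans cf; exact: near_eq_cvg.
apply: is_diff_eq_near df_ _; apply: filterS (near_chart_inv fg) => y.
by rewrite /local_rep /= fgx => ->.
Qed.

Lemma is_mdiff_pair M N P (f : P -> M) (g : P -> N) x df dg :
  is_mdiff f x df -> is_mdiff g x dg ->
  is_mdiff ((fun p => (f p, g p)) : P -> prod_manifold M N) x
    (fun v => (df v, dg v)).
Proof.
move=> [cf df_] [cg dg_]; split; first exact: cvg_pair.
exact: is_diff_pair df_ dg_.
Qed.

Lemma is_mdiff_cst M N (c : N) (x : M) : is_mdiff (fun _ : M => c) x (fun=> 0).
Proof. split; [exact: cvg_cst|exact: is_diff_cst]. Qed.

Lemma is_mdiff_id M (x : M) : is_mdiff (id : M -> M) x id.
Proof.
split; first exact: cvg_id.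
apply: is_diff_eq_near (is_diff_id _) _.
by apply: filterS (near_chart_invK x) => y; rewrite /local_rep /= => ->.
Qed.

Lemma is_mdiff_fst M N (x : prod_manifold M N) :
  is_mdiff (fst : prod_manifold M N -> M) x fst.
Proof.
split; first exact: cvg_fst.
have d := is_diff_fst (chart_at x x : model M * model N).
apply: is_diff_eq_near d _.
by apply: filterS (near_chart_invK x) => y /(congr1 fst) /= <-.
Qed.

Lemma is_mdiff_snd M N (x : prod_manifold M N) :
  is_mdiff (snd : prod_manifold M N -> N) x snd.
Proof.
split; first exact: cvg_snd.
have d := is_diff_snd (chart_at x x : model M * model N).
apply: is_diff_eq_near d _.
by apply: filterS (near_chart_invK x) => y /(congr1 snd) /= <-.
Qed.

Lemma is_mdiff_insl M N (x : M) (c : N) :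
  is_mdiff ((fun y => (y, c)) : M -> prod_manifold M N) x (fun v => (v, 0)).
Proof. exact: is_mdiff_pair (is_mdiff_id x) (is_mdiff_cst c x). Qed.

Lemma is_mdiff_insr M N (x : N) (c : M) :
  is_mdiff ((fun y => (c, y)) : N -> prod_manifold M N) x (fun v => (0, v)).
Proof. exact: is_mdiff_pair (is_mdiff_cst c x) (is_mdiff_id x). Qed.

Lemma is_mdiff_vect (V W : normedVectType R) (f : V -> W) (x : V) df :
  is_diff x f df -> is_mdiff (f : vect_manifold V -> vect_manifold W) x df.
Proof.
by move=> d; split=> //; apply: differentiable_continuous; case: d.
Qed.

(** The chart of [W] is the identity, and near [x] the map [f] is the differentiable
    [f \o chart_inv (chart_at x)] after the chart, hence continuous at [x]. *)
Lemma is_mdiff_to_vect M (W : normedVectType R) (f : M -> W) (x : M) df :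
  is_diff (chart_at x x) (f \o chart_inv (chart_at x)) df ->
  is_mdiff (f : M -> vect_manifold W) x df.
Proof.
move=> d; split=> //.
have [dd _] := d; have dx := chart_at_dom x.
have c := continuous_comp (chart_map_cont dx) (differentiable_continuous dd).
rewrite /prop_for /continuous_at.
have <- : (f \o chart_inv (chart_at x) \o chart_at x) x = f x.
  by rewrite /= chart_mapK.
apply: cvg_trans c; apply: near_eq_cvg.
by apply: filterS (near_chart_dom x) => z zx; rewrite /= chart_mapK.
Qed.

(** * Smoothness at a point *)

Definition msmooth M N (f : M -> N) (x : M) :=
  {for x, continuous f} /\ forall k, Ck_near k (local_rep f x) (chart_at x x).

Lemma smooth_map_msmooth M N (f : M -> N) : smooth_map f -> forall x, msmooth f x.
Proof.
case=> cf sf x; split; first exact: cf.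
move=> k; exists (chart_at x @`
    (chart_dom (chart_at x) `&` f @^-1` chart_dom (chart_at (f x)))).
  split.
    apply: chart_open_image; last by move=> z [].
    apply: openI; first exact: chart_dom_open.
    apply: open_comp; last exact: chart_dom_open.
    by move=> z _; exact: cf.
  by exists x => //; split; exact: chart_at_dom.
exact: sf.
Qed.

Lemma msmooth_differentiable M N (f : M -> N) x : msmooth f x ->
  mdifferentiable f x.
Proof.
case=> cf sf; split=> //; exact: nbhs_singleton (Ck_near_diff (sf 1)).
Qed.

Lemma Ck_near_continuous (E F : normedModType R) k (f : E -> F) x :
  Ck_near k f x -> {for x, continuous f}.
Proof.
case: k => [|k] [U [oU Ux] Cf]; first exact: Cf.
by apply: differentiable_continuous; exact: Cf.1.
Qed.

Lemma Ck_near_eq (E F : normedModType R) k (f g : E -> F) x :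
  Ck_near k f x -> (\forall y \near x, f y = g y) -> Ck_near k g x.
Proof.
case=> U [oU Ux] Cf fg.
have Cf' : Ck_on k (U `&` [set y | f y = g y]°) f.
  by apply: Ck_on_subset Cf => y [].
exists (U `&` [set y | f y = g y]°).
  by split; [apply: openI => //; exact: open_interior|].
apply: eq_Ck_on Cf'; first by apply: openI => //; exact: open_interior.
by move=> y [_ /nbhs_singleton].
Qed.

Lemma Ck_near_comp (E F H : normedModType R) k (f : E -> F) (g : F -> H) x :
  Ck_near k f x -> Ck_near k g (f x) -> Ck_near k (g \o f) x.
Proof.
move=> Cf [V [oV Vfx] Cg]; have cf := Ck_near_continuous Cf.
have Vf : \forall y \near x, V (f y) by apply: cf; exact: open_nbhs_nbhs.
case: Cf => U [oU Ux] Cf.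
exists (U `&` (f @^-1` V)°).
  by split; [apply: openI => //; exact: open_interior|].
apply: (@Ck_on_comp _ _ _ _ _ _ V) => //.
- by apply: openI => //; exact: open_interior.
- by move=> y [_ /nbhs_singleton].
- by apply: Ck_on_subset Cf => y [].
Qed.

Lemma Ck_near_pair (E F H : normedModType R) k (f : E -> F) (g : E -> H) x :
  Ck_near k f x -> Ck_near k g x -> Ck_near k (fun y => (f y, g y)) x.
Proof.
move=> [U [oU Ux] Cf] [V [oV Vx] Cg]; exists (U `&` V).
  by split; [exact: openI|].
apply: Ck_on_pair; first exact: openI.
- by apply: Ck_on_subset Cf => y [].
- by apply: Ck_on_subset Cg => y [].
Qed.

Lemma msmooth_comp M N P (f : M -> N) (g : N -> P) x :
  msmooth f x -> msmooth g (f x) -> msmooth (g \o f) x.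
Proof.
move=> [cf sf] [cg sg]; split; first exact: continuous_comp.
move=> k; apply: Ck_near_eq (near_local_rep_comp g cf).
have e : local_rep f x (chart_at x x) = chart_at (f x) (f x).
  by rewrite /local_rep /= chart_mapK //; exact: chart_at_dom.
by apply: Ck_near_comp => //; rewrite e; exact: sg.
Qed.

Lemma msmooth_pair M N P (f : P -> M) (g : P -> N) x :
  msmooth f x -> msmooth g x ->
  msmooth ((fun p => (f p, g p)) : P -> prod_manifold M N) x.
Proof.
move=> [cf sf] [cg sg]; split; first exact: cvg_pair.
by move=> k; exact: Ck_near_pair.
Qed.

Lemma msmooth_fst M N (x : prod_manifold M N) :
  msmooth (fst : prod_manifold M N -> M) x.
Proof.
split; first exact: cvg_fst.
move=> k; apply: (@Ck_near_eq _ _ k fst).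
  by exists setT; [split=> //; exact: openT|exact: Ck_on_fst].
by apply: filterS (near_chart_invK x) => y /(congr1 fst) /= <-.
Qed.

Lemma msmooth_snd M N (x : prod_manifold M N) :
  msmooth (snd : prod_manifold M N -> N) x.
Proof.
split; first exact: cvg_snd.
move=> k; apply: (@Ck_near_eq _ _ k snd).
  by exists setT; [split=> //; exact: openT|exact: Ck_on_snd].
by apply: filterS (near_chart_invK x) => y /(congr1 snd) /= <-.
Qed.

(** Read in the chart at [y], the chart at [x] is a transition map, smooth by [chart_compat]. *)
Lemma chart_differentiable M (x y : M) : chart_dom (chart_at x) y ->
  mdifferentiable (chart_at x : M -> vect_manifold (model M)) y.
Proof.
move=> xy; split; first exact: chart_map_cont.
have [d _] := chart_compat y x 1; apply: d.
by exists y => //; split=> //; exact: chart_at_dom.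
Qed.

End ManifoldCalculus.

(** * Derivative of Ad and uniqueness of one-parameter subgroups *)

Section LieGroupTheory.
Variables (R : realType) (G : lie_group R).
Local Notation e := (lie_one G).
Local Notation ch := (chart_at e).
Local Notation inv := (chart_inv (chart_at e)).
Local Notation o := (chart_at e e).
Implicit Types (g h : G) (xi eta : lie_alg G).

Lemma lie_mulgV g : lie_mul g (lie_inv g) = e.
Proof.
rewrite -[LHS]lie_mul1g -{1}(lie_mulVg (lie_inv g)) -lie_mulA.
by rewrite (lie_mulA (lie_inv g)) lie_mulVg lie_mul1g lie_mulVg.
Qed.

Lemma lie_mulg1 g : lie_mul g e = g.
Proof. by rewrite -(lie_mulVg g) lie_mulA lie_mulgV lie_mul1g. Qed.

Lemma lie_inv1 : lie_inv e = e.
Proof. by rewrite -[LHS]lie_mulg1 lie_mulVg. Qed.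

Lemma lie_invM g h : lie_inv (lie_mul g h) = lie_mul (lie_inv h) (lie_inv g).
Proof.
have gh : lie_mul (lie_mul g h) (lie_mul (lie_inv h) (lie_inv g)) = e.
  by rewrite lie_mulA -(lie_mulA g) lie_mulgV lie_mulg1 lie_mulgV.
by rewrite -[LHS]lie_mulg1 -gh lie_mulA lie_mulVg lie_mul1g.
Qed.

Let mulG (p : prod_manifold G G) : G := lie_mul p.1 p.2.
Let conjG (p : prod_manifold G G) : G :=
  lie_mul (lie_mul p.1 p.2) (lie_inv p.1).

Lemma msmooth_mul p : msmooth mulG p.
Proof. exact: smooth_map_msmooth (lie_mul_smooth G) p. Qed.

Lemma msmooth_inv g : msmooth (@lie_inv R G) g.
Proof. exact: smooth_map_msmooth (lie_inv_smooth G) g. Qed.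

Lemma msmooth_conj p : msmooth conjG p.
Proof.
have s1 := msmooth_comp (msmooth_fst p) (msmooth_inv p.1).
have s2 := msmooth_pair (msmooth_mul p) s1.
exact: msmooth_comp s2 (msmooth_mul _).
Qed.

Lemma differentiable_lmul g h : mdifferentiable (lie_mul g) h.
Proof.
have d := mdifferentiableP (msmooth_differentiable (msmooth_mul (g, h))).
exact: is_mdiff_differentiable (is_mdiff_comp (is_mdiff_insr h g) d).
Qed.

Let mu (p : model G * model G) : model G := ch (lie_mul (inv p.1) (inv p.2)).
Let kap (p : model G * model G) : model G :=
  ch (lie_mul (lie_mul (inv p.1) (inv p.2)) (lie_inv (inv p.1))).

Let inv_o : inv o = e.
Proof. by rewrite chart_mapK //; exact: chart_at_dom. Qed.

Let mu_rep : local_rep mulG (e, e) = mu.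
Proof. by rewrite /local_rep /mulG /= lie_mul1g. Qed.

Let kap_rep : local_rep conjG (e, e) = kap.
Proof. by rewrite /local_rep /conjG /= lie_mul1g lie_mulgV. Qed.

Let mu_Ck k : Ck_near k mu (o, o).
Proof. by rewrite -mu_rep; have [_] := msmooth_mul (e, e); apply. Qed.

Let kap_Ck k : Ck_near k kap (o, o).
Proof. by rewrite -kap_rep; have [_] := msmooth_conj (e, e); apply. Qed.

Let muo : \forall y \near o, mu (y, o) = y.
Proof.
by apply: filterS (near_chart_invK e) => y yK; rewrite /mu /= inv_o lie_mulg1.
Qed.

Let kapo : \forall y \near o, kap (o, y) = y.
Proof.
apply: filterS (near_chart_invK e) => y yK.
by rewrite /kap /= inv_o lie_inv1 lie_mulg1 lie_mul1g.
Qed.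

Let kap_o : \forall y \near o, kap (y, o) = o.
Proof.
by apply: filterE => y; rewrite /kap /= inv_o lie_mulg1 lie_mulgV.
Qed.

Let mu_kap : \forall p \near (o, o), mu (kap p, p.1) = mu p.
Proof.
have [c _] := msmooth_conj (e, e).
have ce : conjG (e, e) = e by rewrite /conjG /= lie_mul1g lie_mulgV.
have n1 := near_chart_dom e; rewrite -{1}ce in n1.
have n2 := near_chart_inv (c _ n1).
apply: filterS n2 => p /= H.
rewrite /mu /kap /= chart_mapK //.
by rewrite -!lie_mulA lie_mulVg lie_mulg1.
Qed.

(** Conjugation fixes the identity, so its local representative at [e] uses the chart at [e] on both
    sides and is a partial map of [kap]. *)
Lemma Ad_rep xi : \forall y \near o, 'd kap (y, o) (0, xi) = Ad (inv y) xi.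
Proof.
apply: filterS (near_insl (Ck_near_diff (kap_Ck 1))) => y dk.
have d := is_diff_comp (is_diff_insr o y) (differentiableP dk).
have r : local_rep (fun x : G => lie_mul (lie_mul (inv y) x) (lie_inv (inv y))) e
   = fun x => kap (y, x).
  by rewrite /local_rep lie_mulg1 lie_mulgV.
rewrite /Ad /mdiff lfunE /= r.
exact: esym (congr1 (@^~ xi) (diff_val (is_diff_def := d))).
Qed.

(** [field_rep] composes the derivative of left multiplication at [e] with that of the chart at [g];
    by the chain rule this is the derivative of a partial map of [mu]. *)
Lemma left_field_rep xi :
  \forall y \near o, 'd mu (y, o) (0, xi) = field_rep (left_field xi) e y.
Proof.
have n1 := near_insl (Ck_near_diff (mu_Ck 1)).
apply: filterS2 n1 (near_chart_inv (near_chart_dom e)) => y dm yd.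
have d := is_diff_comp (is_diff_insr o y) (differentiableP dm).
set g := inv y in yd *.
have d1 : is_mdiff (lie_mul g) e (mdiff (lie_mul g) e).
  exact: mdifferentiableP (differentiable_lmul g e).
have d2 := mdifferentiableP (chart_differentiable yd).
(* Composition requires the base point in the form [lie_mul g e]. *)
rewrite -[X in is_mdiff _ X _](lie_mulg1 g) in d2.
have [_ d3] := is_mdiff_comp d1 d2.
exact: (congr1 (@^~ xi) (is_diff_uniq d d3)).
Qed.

Lemma left_field1 xi : left_field xi e = xi.
Proof.
have d : is_mdiff (lie_mul e) e id.
  apply: is_mdiff_eq_near (is_mdiff_id e) _.
  by apply: filterE => y; rewrite lie_mul1g.
exact: is_mdiff_mdiff d.
Qed.

Lemma lie_bracketE xi eta : lie_bracket xi eta =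
  'd (fun y => 'd mu (y, o) (0, eta)) o xi - 'd (fun y => 'd mu (y, o) (0, xi)) o eta.
Proof.
rewrite /lie_bracket /field_bracket !left_field1.
have [_ ->] := near_eq_diff (left_field_rep eta)
  (differentiable_left_field_rep (mu_Ck 2) eta).
by have [_ ->] := near_eq_diff (left_field_rep xi)
  (differentiable_left_field_rep (mu_Ck 2) xi).
Qed.

(** In the chart at [e], [Ad] is the partial derivative of [kap], and [diff_conj_rep] differs from
    [lie_bracketE] exactly by a sign. *)
Lemma Ad_is_mdiff xi :
  is_mdiff ((fun g => Ad g xi) : G -> vect_manifold (lie_alg G)) e
    (fun eta => - lie_bracket xi eta).
Proof.
apply: is_mdiff_to_vect.
have dA := differentiable_conj_rep (kap_Ck 2) xi.
apply: is_diff_eq_near _ (Ad_rep xi).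
apply: is_diff_eq (differentiableP dA) _; apply/funext => eta.
rewrite lie_bracketE opprB.
exact: (diff_conj_rep (mu_Ck 2) (kap_Ck 2) muo kapo kap_o mu_kap).
Qed.

(** The linearity that [linfun] requires comes for free: minus the bracket is a derivative, that of
    [Ad]. *)
Lemma adE xi eta : ad xi eta = lie_bracket xi eta.
Proof.
apply: linear_linfunE => a u v; apply: oppr_inj.
have [_ [_ E]] := Ad_is_mdiff xi.
have E' w := congr1 (@^~ w) E.
by rewrite /= in E'; rewrite -!E' linearP opprD -scalerN -!E'.
Qed.

Lemma Ad1 xi : Ad e xi = xi.
Proof.
have d : is_mdiff (fun x : G => lie_mul (lie_mul e x) (lie_inv e)) e id.
  apply: is_mdiff_eq_near (is_mdiff_id e) _.
  by apply: filterE => y; rewrite lie_mul1g lie_inv1 lie_mulg1.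
exact: is_mdiff_mdiff d.
Qed.

(** In a chart, [mean_value_ineq] with bound 0 makes [f] locally constant; its level sets are then
    open and closed in the connected line. *)
Lemma zero_mdiff_constant (M : manifold R) (f : real_line R -> M) :
  (forall t, is_mdiff f t (fun=> 0)) -> forall s t : R, f s = f t.
Proof.
move=> df.
have loc (t : R) : \forall s \near t, f s = f t.
  have [cf _] := df t.
  have /nbhs_ballP[r /= r0 Hr] := cf _ (near_chart_dom (f t)).
  pose k (s : R) := chart_at (f t) (f s).
  have dk s : ball t r s -> is_diff s k (fun h : R => h *: 0).
    move=> /Hr fs.
    have [_ d] := is_mdiff_comp (df s) (mdifferentiableP (chart_differentiable fs)).
    by apply: is_diff_eq d _; apply/funext => h /=; rewrite linear0 scaler0.
  have kK a b : a <= b -> ball t r a -> ball t r b -> k a = k b.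
    move=> ab ta tb; apply/eqP; rewrite eq_sym -subr_eq0 -normr_le0.
    have := @mean_value_ineq R _ k (fun=> 0) a b 0 ab.
    rewrite mul0r normr0; apply=> // s /andP[as_ sb]; apply: dk.
    move: ta tb; rewrite -ball_normE /= !ltr_distl => /andP[a1 a2] /andP[b1 b2].
    by apply/andP; split; lra.
  apply/nbhs_ballP; exists r => // s ts.
  have tt : ball t r t by exact: ballxx.
  have : k s = k t.
    by have [st|/ltW ts'] := leP s t; [exact: kK|apply/esym; exact: kK].
  move=> /(congr1 (chart_inv (chart_at (f t)))).
  by rewrite /k !chart_mapK //; [exact: chart_at_dom|exact: Hr].
move=> s t.
have oS u : open [set v : R | f v = u].
  by rewrite openE => v /= <-; exact: loc.
have /connected_intervalP : is_interval [set: R] by [].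
move=> /(_ [set v : R | f v = f t]) H.
have : [set v : R | f v = f t] = setT.
  apply: H; first by exists t.
  - by exists [set v : R | f v = f t]; rewrite ?setTI.
  - exists [set v : R | f v = f t]; rewrite ?setTI //.
    rewrite -openC openE => v /= vt.
    by apply: filterS (loc v) => w /= ->.
by move=> /seteqP[_ /(_ s)]; apply.
Qed.

(** * One-parameter subgroups, exponential and infinitesimal generators *)

Section OneParameter.
Implicit Types c d : real_line R -> G.

Lemma one_parameter0 c xi : one_parameter_subgroup xi c -> c 0 = e.
Proof.
move=> [_ cD _]; have := cD 0 0; rewrite addr0.
move=> /(congr1 (lie_mul (lie_inv (c 0)))).
by rewrite lie_mulA lie_mulVg lie_mul1g.
Qed.

Lemma one_parameter_is_mdiff c xi : one_parameter_subgroup xi c ->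
  is_mdiff c 0 (fun t => t *: xi).
Proof.
move=> [sc _ <-].
have d := mdifferentiableP (msmooth_differentiable (smooth_map_msmooth sc 0)).
have e1 : (mdiff c 0 : R -> model G) = (fun t : R => t *: velocity c 0).
  apply/funext => t; rewrite /velocity -linearZ /=; congr (mdiff c 0 _).
  exact: esym (mulr1 t).
by rewrite -e1.
Qed.

(* k = c d^-1 has derivative zero at 0, because (x, y) |-> x y^-1 is constant on the
   diagonal, hence everywhere, because k (t + s) = c t * k s * (d t)^-1. *)
Lemma one_parameter_uniq c d xi : one_parameter_subgroup xi c ->
  one_parameter_subgroup xi d -> c = d.
Proof.
move=> oc od.
have c0 := one_parameter0 oc; have d0 := one_parameter0 od.
have dc := one_parameter_is_mdiff oc; have dd := one_parameter_is_mdiff od.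
have [_ cD _] := oc; have [_ dD _] := od.
pose Phi (p : prod_manifold G G) : G := lie_mul p.1 (lie_inv p.2).
have dPhi p : is_mdiff Phi p (mdiff Phi p).
  have s1 := msmooth_comp (msmooth_snd p) (msmooth_inv p.2).
  have s2 := msmooth_pair (msmooth_fst p) s1.
  apply: mdifferentiableP; apply: msmooth_differentiable.
  exact: msmooth_comp s2 (msmooth_mul _).
pose k (t : real_line R) := Phi (c t, d t).
have dk : is_mdiff k 0 (fun=> 0).
  have d1 := is_mdiff_comp (is_mdiff_pair dc dd) (dPhi (c 0, d 0)).
  have d2 := is_mdiff_comp (is_mdiff_pair (is_mdiff_id e) (is_mdiff_id e))
    (dPhi (e, e)).
  have d3 : is_mdiff (fun g : G => Phi (g, g)) e (fun=> 0).
    apply: is_mdiff_eq_near (is_mdiff_cst e e) _.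
    by apply: filterE => g; rewrite /Phi /= lie_mulgV.
  have E := is_mdiff_uniq d2 d3.
  rewrite c0 d0 in d1.
  have -> : (fun=> 0 : model G) =
      mdiff Phi (e, e) \o (fun v : R => (v *: xi, v *: xi)).
    by apply/funext => v; have /= := congr1 (@^~ (v *: xi)) E.
  exact: d1.
have dkt t : is_mdiff k t (fun=> 0).
  pose sh (s : real_line R) : real_line R := (s : R) - (t : R).
  have dsh : is_mdiff sh t id.
    apply: is_mdiff_vect.
    apply: is_diff_eq (is_diffB (is_diff_id (t : R)) (is_diff_cst (t : R) (t : R))) _.
    by apply/funext => h; rewrite !fctE subr0.
  have dk' : is_mdiff k (sh t) (fun=> 0) by rewrite /sh subrr.
  pose L x : G := lie_mul (c t) (lie_mul x (lie_inv (d t))).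
  have dL x : is_mdiff L x (mdiff L x).
    have d1 := is_mdiff_comp (is_mdiff_insl x (lie_inv (d t)))
      (mdifferentiableP (msmooth_differentiable (msmooth_mul _))).
    have d2 := is_mdiff_comp d1 (mdifferentiableP (differentiable_lmul (c t) _)).
    exact: mdifferentiableP (is_mdiff_differentiable d2).
  have d1 := is_mdiff_comp (is_mdiff_comp dsh dk') (dL _).
  have E : (fun=> 0 : model G) = mdiff L ((k \o sh) t) \o ((fun=> 0) \o (id : R -> R)).
    by apply/funext => h /=; rewrite linear0.
  rewrite E; apply: is_mdiff_eq_near d1 _; apply: filterE => s.
  have es : s = (t : R) + (sh s : R) by rewrite addrC subrK.
  have cs : c s = lie_mul (c t) (c (sh s)) by rewrite -cD -es.
  have ds : d s = lie_mul (d t) (d (sh s)) by rewrite -dD -es.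
  by rewrite /L /k /Phi /= cs ds lie_invM !lie_mulA.
apply/funext => t.
have : k t = e.
  by rewrite (zero_mdiff_constant dkt t 0) /k /Phi /= c0 d0 lie_mulgV.
move=> /(congr1 (fun g => lie_mul g (d t))).
by rewrite /k /Phi /= -lie_mulA lie_mulVg lie_mulg1 lie_mul1g.
Qed.

Lemma one_parameter_scale c xi (r : R) : one_parameter_subgroup xi c ->
  one_parameter_subgroup (r *: xi) (fun t : R => c (r * t)).
Proof.
move=> oc; have [[cc sc] cD _] := oc.
have cr : continuous (fun t : R => r * t) by exact: mulrl_continuous.
split.
- split; first by move=> t; apply: continuous_comp; [exact: cr|exact: cc].
  move=> x y k.
  have oV : open ((id : R -> R) @` (setT `&` c @^-1` chart_dom (chart_at y))).
    rewrite image_id setTI; apply: open_comp; last exact: chart_dom_open.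
    by move=> t _; exact: cc.
  apply: (@Ck_on_comp _ _ _ _ _ _ _ (fun t : R => r * t) _ _ oV _ _ (sc x y k)).
  + rewrite /= image_id setTI; apply: open_comp; last exact: chart_dom_open.
    by move=> t _; apply: continuous_comp; [exact: cr|exact: cc].
  + by move=> _ [t [_ ct] <-]; exists (r * t).
  + by apply: (@Ck_on_linear R k R R _ ( *:%R r)); exact: cr.
- by move=> s t; rewrite mulrDr cD.
- have d0 : is_diff (0 : R) (fun t : R => r * t) (fun t : R => r * t).
    exact: is_diff_scaler.
  have d1 := is_mdiff_vect d0.
  have d2 : is_mdiff c (r * 0) (fun t => t *: xi).
    by rewrite mulr0; exact: one_parameter_is_mdiff.
  by rewrite /velocity (is_mdiff_mdiff _ (is_mdiff_comp d1 d2)) /= mulr1.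
Qed.

(** The rescaled subgroup s |-> c (t s) has velocity [t *: xi] and value [c t] at 1; by uniqueness,
    whatever subgroup [xget] picks gives this value. *)
Lemma lie_exp_one_parameter c xi (t : R) : one_parameter_subgroup xi c ->
  lie_exp (t *: xi) = c t.
Proof.
move=> oc; have ot := one_parameter_scale t oc.
rewrite /lie_exp; case: xgetP => [_ -> [d od <-]|/(_ (c t))].
  by rewrite (one_parameter_uniq od ot) mulr1.
by case; exists (fun s : R => c (t * s)) => //; rewrite mulr1.
Qed.

(* xget then returns its default value lie_one G. *)
Lemma lie_exp_default xi (t : R) :
  (forall c, ~ one_parameter_subgroup xi c) -> lie_exp (t *: xi) = e.
Proof.
move=> no; rewrite /lie_exp; case: xgetP => [_ -> [d od <-]|//].
(* For [t = 0], scaling [d] by 0 shows that it is constant. Otherwise scaling it by [t^-1] yields a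
   subgroup with velocity [xi], which was excluded. *)
have [t0|t0] := eqVneq t 0.
  rewrite t0 scale0r in od.
  have ot := one_parameter_scale 0 od; rewrite scaler0 in ot.
  by rewrite (one_parameter_uniq od ot) mul0r (one_parameter0 od).
case: (no (fun s : R => d (t^-1 * s))).
by have := one_parameter_scale t^-1 od; rewrite scalerA mulVf // scale1r.
Qed.

Lemma differentiable_orbit (M : manifold R) (act : G -> M -> M) m :
  lie_action act -> forall g, mdifferentiable (act^~ m) g.
Proof.
move=> [_ sact] g.
have d := mdifferentiableP (msmooth_differentiable (smooth_map_msmooth sact (g, m))).
exact: is_mdiff_differentiable (is_mdiff_comp (is_mdiff_insl g m) d).
Qed.

(* The second case, where no one-parameter subgroup has velocity xi, never occurs,
   but excluding it would require solving an ODE. *)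
Lemma inf_generatorE (M : manifold R) (act : G -> M -> M) xi m :
  lie_action act ->
  inf_generator act xi m = mdiff (act^~ m) e xi \/ inf_generator act xi m = 0.
Proof.
move=> lact; have [[act1 _] _] := lact.
have [[c oc]|no] := pselect (exists c, one_parameter_subgroup xi c).
  left.
  have E : (fun t : real_line R => act (lie_exp ((t : R) *: xi)) m) = (act^~ m) \o c.
    by apply/funext => t /=; rewrite (lie_exp_one_parameter _ oc).
  rewrite /inf_generator E.
  have dm : is_mdiff (act^~ m) e (mdiff (act^~ m) e).
    exact: mdifferentiableP (differentiable_orbit m lact e).
  have d1 := one_parameter_is_mdiff oc.
  rewrite -(one_parameter0 oc) in dm.
  rewrite /velocity (is_mdiff_mdiff _ (is_mdiff_comp d1 dm)) /= scale1r.
  by rewrite (one_parameter0 oc).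
right.
have E : (fun t : real_line R => act (lie_exp ((t : R) *: xi)) m) = (fun=> m).
  apply/funext => t; rewrite lie_exp_default ?act1 // => c oc.
  by apply: no; exists c.
by rewrite /inf_generator E /velocity (is_mdiff_mdiff _ (is_mdiff_cst _ _)).
Qed.

End OneParameter.

End LieGroupTheory.

(** * Relative critical points *)

Section RelativeCriticalPoints.
Variable R : realType.

(** The kernel of a transpose is the annihilator of the range, the form in which the conditions are
    checked. *)
Lemma mem_lker_dual_map (V W : vectType R) (L : 'Hom(V, W)) (l : dual W) :
  l \in lker (dual_map L) <-> forall v, (l : 'Hom(W, R)) (L v) = 0.
Proof.
rewrite memv_ker; split=> [/eqP l0 v|lL].
  by rewrite -dual_mapE l0 zero_lfunE.
by apply/eqP/lfunP => v; rewrite dual_mapE lL zero_lfunE.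
Qed.

Lemma mem_lker_lrestrict (V W : vectType R) (U : {vspace V}) (L : 'Hom(V, W))
    (l : dual W) : l \in lker (dual_map (lrestrict U L)) <->
  forall u, u \in U -> (l : 'Hom(W, R)) (L u) = 0.
Proof.
apply: (iff_trans (mem_lker_dual_map _ _)); split=> lL u.
  by move=> uU; have := lL (Subvs uU); rewrite lrestrictE.
by rewrite lrestrictE lL // subvsP.
Qed.

Variables (G : lie_group R) (M : manifold R).
Local Notation e := (lie_one G).

Section Differentials.
Variables (N : manifold R) (Psi : phase G M -> N) (m : M) (xi : lie_alg G).
Hypothesis dPsi : mdifferentiable Psi (m, xi).

Lemma is_mdiff_m : is_mdiff (fun m' : M => Psi (m', xi)) m
  (fun v => mdiff Psi (m, xi) ((v, 0) : model M * lie_alg G)).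
Proof.
exact: is_mdiff_comp (@is_mdiff_insl _ M (vect_manifold (lie_alg G)) m xi)
  (mdifferentiableP dPsi).
Qed.

Lemma diff_mE v :
  diff_m Psi m xi v = mdiff Psi (m, xi) ((v, 0) : model M * lie_alg G).
Proof. exact: is_mdiff_mdiff is_mdiff_m. Qed.

(** The map g |-> Psi (g m, Ad_g xi) is constant; its derivative at the identity pairs the orbit
    direction with [- lie_bracket xi eta], by [Ad_is_mdiff]. The orbit direction is the differential
    of the orbit map, which [inf_generatorE] relates to the generator. *)
Lemma orbit_diff (act : G -> M -> M) : lie_action act ->
  (forall g, Psi (act g m, Ad g xi) = Psi (m, xi)) ->
  forall eta, diff_m Psi m xi (mdiff (act^~ m) e eta) = diff_xi Psi m xi (ad xi eta).
Proof.
move=> lact inv eta; have [[act1 _] _] := lact.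
have d1 := is_mdiff_pair (mdifferentiableP (differentiable_orbit m lact e))
  (Ad_is_mdiff xi).
have d2 : is_mdiff Psi (act e m, Ad e xi) (mdiff Psi (m, xi)).
  by rewrite act1 Ad1; exact: mdifferentiableP.
have d3 := is_mdiff_comp d1 d2.
have d4 : is_mdiff (fun g : G => Psi (act g m, Ad g xi)) e (fun=> 0).
  apply: is_mdiff_eq_near (is_mdiff_cst (Psi (m, xi)) e) _.
  by apply: filterE => g; rewrite inv.
have := congr1 (@^~ eta) (is_mdiff_uniq d3 d4).
rewrite diff_mE diff_xiE adE /=.
set v := mdiff _ _ _; set w := lie_bracket _ _ => H.
have E : ((v, - w) : model M * lie_alg G) = (v, 0) - (0, w).
  have -> : (v, 0) - (0, w) = ((v - 0, 0 - w) : model M * lie_alg G) by [].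
  by rewrite subr0 sub0r.
move: H; rewrite E linearB /= => /eqP; rewrite subr_eq0 => /eqP.
exact.
Qed.

End Differentials.

Lemma relative_critical_pointE (Q : manifold R) (iota : phase G M -> Q)
    (f : Q -> R) (m : M) (xi : lie_alg G) :
  mdifferentiable iota (m, xi) ->
  mdifferentiable (f : Q -> real_line R) (iota (m, xi)) ->
  relative_critical_point (fun p => f (iota p)) (m, xi) <->
  forall v, scalar_diff f (iota (m, xi)) (diff_m iota m xi v) = 0.
Proof.
move=> di df.
have d := is_mdiff_comp (is_mdiff_m di) (mdifferentiableP df).
have E v : scalar_diff (fun m' => f (iota (m', xi))) m v =
    scalar_diff f (iota (m, xi)) (diff_m iota m xi v).
  by rewrite diff_mE //; exact: is_mdiff_mdiff d.
split=> [[_ crit] v|crit].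
  by rewrite -E; rewrite crit zero_lfunE.
split; first exact: is_mdiff_differentiable d.
by apply/lfunP => v; rewrite E crit zero_lfunE.
Qed.

(** * Criticality conditions for general and for product-valued invariant maps *)

Section Equivalences.
Variables (act : G -> M -> M) (lact : lie_action act).
Variables (m : M) (xi : lie_alg G) (Vint : {vspace tangent m}).
Hypothesis Vint_orbit : forall v : tangent m,
  exists u : tangent m, exists eta : lie_alg G,
    u \in Vint /\ v = u + inf_generator act eta m.

Lemma critical_iff (Q : manifold R) (iota : phase G M -> Q) (f : Q -> R) :
  mdifferentiable iota (m, xi) ->
  (forall g, iota (act g m, Ad g xi) = iota (m, xi)) ->
  mdifferentiable (f : Q -> real_line R) (iota (m, xi)) ->
  relative_critical_point (fun p => f (iota p)) (m, xi) <->
  scalar_diff f (iota (m, xi)) \in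
    (K_rig iota m xi :&:
     lker (dual_map (lrestrict Vint (diff_m iota m xi))))%VS.
Proof.
move=> di inv df; apply: (iff_trans (relative_critical_pointE di df)).
have orb := orbit_diff di lact inv.
rewrite memv_cap; split=> [crit|/andP[]].
  apply/andP; split.
    by apply/mem_lker_dual_map => eta; rewrite comp_lfunE -orb.
  by apply/mem_lker_lrestrict => u _; exact: crit.
move=> /mem_lker_dual_map rig /mem_lker_lrestrict int v.
have [u [eta [uV ->]]] := Vint_orbit v.
rewrite !linearD /= int // add0r.
(* The generator is either the orbit direction, handled by [orb], or zero; [df] vanishes on it in
   both cases. *)
have [->|->] := inf_generatorE eta m lact; last by rewrite !linear0.
by rewrite orb; have := rig eta; rewrite comp_lfunE.
Qed.

Section Product.
Variables (QM Qchi Qg : manifold R).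
Variables (phi : M -> QM) (chi : phase G M -> Qchi) (alpha : lie_alg G -> Qg).
Variable f : prod3 QM Qchi Qg -> R.
Let iota : phase G M -> prod3 QM Qchi Qg :=
  fun p => (phi p.1, chi p, alpha p.2).
Hypothesis di : mdifferentiable iota (m, xi).
Hypothesis inv : forall g, iota (act g m, Ad g xi) = iota (m, xi).

(** Differentiability of [phi], and likewise of [chi] and [alpha], is drawn from that of [iota] by
    projecting, after insertion of a factor of the phase space where necessary. *)
Let dphi : mdifferentiable phi m.
Proof.
have d := is_mdiff_comp (is_mdiff_comp (is_mdiff_m di) (is_mdiff_fst _))
  (is_mdiff_fst _).
exact: is_mdiff_differentiable d.
Qed.

Let dchi : mdifferentiable chi (m, xi).
Proof.
have d := is_mdiff_comp (is_mdiff_comp (mdifferentiableP di) (is_mdiff_fst _))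
  (is_mdiff_snd _).
exact: is_mdiff_differentiable d.
Qed.

Let dalpha : mdifferentiable (alpha : vect_manifold (lie_alg G) -> Qg) xi.
Proof.
have d := is_mdiff_comp (is_mdiff_comp
  (@is_mdiff_insr _ M (vect_manifold (lie_alg G)) xi m) (mdifferentiableP di))
  (is_mdiff_snd _).
exact: is_mdiff_differentiable d.
Qed.

Let mdiff_iota v w : mdiff iota (m, xi) ((v, w) : model M * lie_alg G) =
  ((mdiff phi m v, mdiff chi (m, xi) ((v, w) : model M * lie_alg G)),
    mdiff (alpha : vect_manifold (lie_alg G) -> Qg) xi w).
Proof.
have d1 := is_mdiff_comp (@is_mdiff_fst _ M (vect_manifold (lie_alg G)) (m, xi))
  (mdifferentiableP dphi).
have d2 := is_mdiff_comp (@is_mdiff_snd _ M (vect_manifold (lie_alg G)) (m, xi))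
  (mdifferentiableP dalpha).
exact: is_mdiff_mdiff
  (is_mdiff_pair (is_mdiff_pair d1 (mdifferentiableP dchi)) d2).
Qed.

(** The last component of the invariance makes [alpha] constant on the adjoint orbit of [xi], whose
    tangent directions at [xi] form the range of [ad xi]. *)
Let diff_alpha_ad eta :
  mdiff (alpha : vect_manifold (lie_alg G) -> Qg) xi (ad xi eta) = 0.
Proof.
have d2 : is_mdiff (alpha : vect_manifold (lie_alg G) -> Qg) (Ad e xi)
    (mdiff (alpha : vect_manifold (lie_alg G) -> Qg) xi).
  by rewrite Ad1; exact: mdifferentiableP.
have d3 := is_mdiff_comp (Ad_is_mdiff xi) d2.
have d4 : is_mdiff (fun g : G => alpha (Ad g xi)) e (fun=> 0).
  apply: is_mdiff_eq_near (is_mdiff_cst (alpha xi) e) _.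
  by apply: filterE => g; have := inv g => -[_ _ ->].
have := congr1 (@^~ eta) (is_mdiff_uniq d3 d4).
by rewrite /= linearN adE => /eqP; rewrite oppr_eq0 => /eqP.
Qed.

Let df_phi := partial_phi f (iota (m, xi)).
Let df_chi := partial_chi f (iota (m, xi)).

Let split_df a b : scalar_diff f (iota (m, xi))
    ((a, b, 0) : model QM * model Qchi * model Qg) = df_phi a + df_chi b.
Proof.
rewrite partial_phiE partial_chiE -linearD.
have -> : ((a, b, 0) : model QM * model Qchi * model Qg) = (a, 0, 0) + (0, b, 0).
  have -> : (a, 0, 0) + (0, b, 0) =
    ((a + 0, 0 + b, 0 + 0) : model QM * model Qchi * model Qg) by [].
  by rewrite !addr0 add0r.
by [].
Qed.

(** Along [ad xi] only [chi] contributes, since [phi] is independent of [xi] and [diff_alpha_ad]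
    removes [alpha] ([E1]). Along [Vint] only [phi] and [chi] contribute, since [alpha] is
    independent of [m] ([E2]). *)
Lemma product_cond_iff :
  scalar_diff f (iota (m, xi)) \in
    (K_rig iota m xi :&:
     lker (dual_map (lrestrict Vint (diff_m iota m xi))))%VS <->
  df_chi \in K_rig chi m xi /\
  dual_map (lrestrict Vint (mdiff phi m)) df_phi +
    dual_map (lrestrict Vint (diff_m chi m xi)) df_chi = 0.
Proof.
have E1 eta : scalar_diff f (iota (m, xi)) (diff_xi iota m xi (ad xi eta)) =
    df_chi (diff_xi chi m xi (ad xi eta)).
  by rewrite !diff_xiE mdiff_iota diff_alpha_ad split_df !linear0 add0r.
have E2 v : scalar_diff f (iota (m, xi)) (diff_m iota m xi v) =
    df_phi (mdiff phi m v) + df_chi (diff_m chi m xi v).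
  by rewrite !diff_mE // mdiff_iota linear0 split_df.
rewrite memv_cap; split.
  move=> /andP[/mem_lker_dual_map rig /mem_lker_lrestrict int]; split.
    apply/mem_lker_dual_map => eta; have := rig eta.
    by rewrite !comp_lfunE E1.
  apply/lfunP => u; rewrite add_lfunE !dual_mapE !lrestrictE -E2 zero_lfunE.
  by apply: int; exact: subvsP.
move=> [/mem_lker_dual_map rig int]; apply/andP; split.
  apply/mem_lker_dual_map => eta; have := rig eta.
  by rewrite !comp_lfunE E1.
apply/mem_lker_lrestrict => u uV; rewrite E2.
have := congr1 (fun l : 'Hom(_, _) => l (Subvs uV)) int.
by rewrite add_lfunE !dual_mapE !lrestrictE zero_lfunE.
Qed.

End Product.

End Equivalences.

(** If the sum vanishes, then L x = L' (- y) lies in both ranges, hence is zero, and so is L' y. *)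
Lemma trivial_cap_split (V W U : vectType R) (K : {vspace V}) (L : 'Hom(V, W))
    (L' : 'Hom(U, W)) (x : V) (y : U) :
  (limg L' :&: (L @: K))%VS = 0%VS ->
  (x \in K /\ L' y + L x = 0) <-> (y \in lker L' /\ x \in (K :&: lker L)%VS).
Proof.
move=> cap0; rewrite memv_cap !memv_ker; split; last first.
  by move=> [/eqP -> /andP[-> /eqP ->]]; rewrite addr0.
move=> [xK E].
have Ly : L' y = - L x by apply/eqP; rewrite -addr_eq0 E.
have : L x \in (limg L' :&: (L @: K))%VS.
  rewrite memv_cap memv_img // andbT -[L x]opprK -Ly -linearN /=.
  exact: memv_img (memvf _).
by rewrite cap0 memv0 Ly => /eqP ->; rewrite oppr0 !eqxx xK.
Qed.

End RelativeCriticalPoints.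

Theorem corollary1 (R : realType) (G : lie_group R) (Gt : groupType)
    (M : manifold R) (act : G -> M -> M)
    (actt : Gt -> lie_alg G -> lie_alg G)
    (act_lie : lie_action act)
    (actt_action : is_action (1%g : Gt) (fun h k : Gt => (h * k)%g) actt)
    (actt_Ad : forall (g : G) (h : Gt) (eta : lie_alg G),
      actt h (Ad g eta) = Ad g (actt h eta))
    (m : M) (xi : lie_alg G) (Vint : {vspace tangent m})
    (Vint_orbit : forall v : tangent m,
      exists u : tangent m, exists eta : lie_alg G,
        u \in Vint /\ v = u + inf_generator act eta m) :
  (forall (Q : manifold R) (iota : phase G M -> Q) (f : Q -> R),
    (forall p, mdifferentiable iota p) ->
    (forall (g : G) (h : Gt) (m' : M) (eta : lie_alg G),
      iota (act g m', actt h (Ad g eta)) = iota (m', eta)) ->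
    (forall q, mdifferentiable (f : Q -> real_line R) q) ->
    relative_critical_point (fun p => f (iota p)) (m, xi) <->
    scalar_diff f (iota (m, xi)) \in
      (K_rig iota m xi :&:
       lker (dual_map (lrestrict Vint (diff_m iota m xi))))%VS) /\
  (forall (QM Qchi Qg : manifold R)
      (phi : M -> QM) (chi : phase G M -> Qchi) (alpha : lie_alg G -> Qg)
      (f : prod3 QM Qchi Qg -> R),
    let iota : phase G M -> prod3 QM Qchi Qg :=
      fun p => (phi p.1, chi p, alpha p.2) in
    let df_phi := partial_phi f (iota (m, xi)) in
    let df_chi := partial_chi f (iota (m, xi)) in
    let dphi := lrestrict Vint (mdiff phi m) in
    let dchi := lrestrict Vint (diff_m chi m xi) in
    let cond1 :=
      scalar_diff f (iota (m, xi)) \in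
        (K_rig iota m xi :&:
         lker (dual_map (lrestrict Vint (diff_m iota m xi))))%VS in
    let cond2 :=
      df_chi \in K_rig chi m xi /\
      dual_map dphi df_phi + dual_map dchi df_chi = 0 in
    let cond3 :=
      df_phi \in lker (dual_map dphi) /\
      df_chi \in (K_rig chi m xi :&: lker (dual_map dchi))%VS in
    (forall p, mdifferentiable iota p) ->
    (forall (g : G) (h : Gt) (m' : M) (eta : lie_alg G),
      iota (act g m', actt h (Ad g eta)) = iota (m', eta)) ->
    (forall q, mdifferentiable (f : prod3 QM Qchi Qg -> real_line R) q) ->
    (cond1 <-> cond2) /\
    ((limg (dual_map dphi) :&: (dual_map dchi @: K_rig chi m xi))%VS = 0%VS ->
      (cond2 <-> cond3))).
Proof.
have [actt1 _] := actt_action.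
split=> [Q iota f di inv df|QM Qchi Qg phi chi alpha f iota].
  apply: (critical_iff act_lie Vint_orbit) => // g.
  (* The identity of [Gt] acts trivially, so taking it for [h] extracts the invariance under [G]. *)
  by have := inv g 1%g m xi; rewrite actt1.
move=> df_phi df_chi dphi dchi cond1 cond2 cond3 di inv df; split.
  apply: (product_cond_iff (act := act) Vint f (di (m, xi))) => g.
  by have := inv g 1%g m xi; rewrite actt1.
exact: trivial_cap_split.
Qed.
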